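(* Let $\xi=(\xi_k)_{k\in\mathbf{N}_0}$ be a sequence of independent and identically distributed $\mathbf{R}^Z$-valued random vectors with (common) support $\mathbf{\Xi}\subset\mathbf{R}^Z$, and consider the generalized plant $$x_{k+1}=A_{\mathrm o}(\xi_k)x_k+B_{\mathrm{o}w}(\xi_k)w_k+B_{\mathrm{o}u}(\xi_k)u_k,\qquad z_k=C_{\mathrm o}(\xi_k)x_k+D_{\mathrm{o}w}(\xi_k)w_k+D_{\mathrm{o}u}(\xi_k)u_k,$$ where $A_{\mathrm o}:\mathbf{\Xi}\to\mathbf{R}^{n\times n}$, $B_{\mathrm{o}w}:\mathbf{\Xi}\to\mathbf{R}^{n\times p_w}$, $B_{\mathrm{o}u}:\mathbf{\Xi}\to\mathbf{R}^{n\times p_u}$, $C_{\mathrm o}:\mathbf{\Xi}\to\mathbf{R}^{q_z\times n}$, $D_{\mathrm{o}w}:\mathbf{\Xi}\to\mathbf{R}^{q_z\times p_w}$, $D_{\mathrm{o}u}:\mathbf{\Xi}\to\mathbf{R}^{q_z\times p_u}$ are Borel functions such that the squares of all entries of $A_{\mathrm o}(\xi_0)$, $B_{\mathrm{o}w}(\xi_0)$, $B_{\mathrm{o}u}(\xi_0)$, $C_{\mathrm o}(\xi_0)$, $D_{\mathrm{o}w}(\xi_0)$, $D_{\mathrm{o}u}(\xi_0)$ are Lebesgue integrable (have finite expectation). For $F\in\mathbf{R}^{p_u\times n}$ let $G_F$ be the closed-loop system obtained with the state feedback $u_k=Fx_k$. For given $\gamma>0$, there exists a gain $F\in\mathbf{R}^{p_u\times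 n}$ such that $G_F$ is exponentially stable in the second moment and satisfies $\|G_F\|_2<\gamma$ if and only if there exist a (symmetric) positive definite $X\in\mathbf{R}^{n\times n}$, a matrix $Y\in\mathbf{R}^{p_u\times n}$ and a symmetric matrix $R\in\mathbf{R}^{p_w\times p_w}$ satisfying $$\begin{bmatrix}X&*&*\\ \widetilde A_{\mathrm o}X+\widetilde B_{\mathrm{o}u}Y&X\otimes I_{\bar n_u}&*\\ \widetilde C_{\mathrm o}X+\widetilde D_{\mathrm{o}u}Y&0&I_{q_z\bar q_{zu}}\end{bmatrix}>0,$$ $$\begin{bmatrix}R-E_D&*\\ \widetilde B_{\mathrm{o}w}&X\otimes I_{\bar p_w}\end{bmatrix}>0,$$ $$\mathrm{tr}(R)<\gamma^2,$$ where $*$ denotes the transpose of the corresponding submatrix (so that the matrices are symmetric), $E_D:=E[D_{\mathrm{o}w}(\xi_0)^TD_{\mathrm{o}w}(\xi_0)]$, and $\widetilde A_{\mathrm o},\widetilde B_{\mathrm{o}u},\widetilde C_{\mathrm o},\widetilde D_{\mathrm{o}u},\widetilde B_{\mathrm{o}w}$ are the constant matrices (with associated integers $\bar n_u,\bar q_{zu},\bar p_w$) defined in the context from second moments of the plant coefficients. In particular, for any such $X,Y,R$, $F=YX^{-1}$ is one such gain.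
   Context: $\mathbf{N}_0$ denotes the non-negative integers. For symmetric matrices, $>0$ means positive definite; $\otimes$ is the Kronecker product and $I_m$ the $m\times m$ identity. For a matrix $M$ with $m$ rows, $\mathrm{row}(M):=[\mathrm{row}_1(M),\ldots,\mathrm{row}_m(M)]$ is the row vector obtained by concatenating the rows of $M$ in order. In the plant, $x_k$ is the state, $w_k$ the disturbance input, $u_k$ the control input, $z_k$ the output, and the initial state $x_0$ is deterministic. Constant matrices. Let $\bar G_{AB}\in\mathbf{R}^{\bar n_u\times(n+p_u)n}$ ($\bar n_u\le(n+p_u)n$), $\bar G_{CD}\in\mathbf{R}^{\bar q_{zu}\times(n+p_u)q_z}$ ($\bar q_{zu}\le(n+p_u)q_z$) and $\bar B_{\mathrm{o}w}\in\mathbf{R}^{\bar p_w\times np_w}$ ($\bar p_w\le np_w$) be matrices satisfying $$\bar G_{AB}^T\bar G_{AB}=E\big[[\mathrm{row}(A_{\mathrm o}(\xi_0)),\mathrm{row}(B_{\mathrm{o}u}(\xi_0))]^T[\mathrm{row}(A_{\mathrm o}(\xi_0)),\mathrm{row}(B_{\mathrm{o}u}(\xi_0))]\big],$$ $$\bar G_{CD}^T\bar G_{CD}=E\big[[\mathrm{row}(C_{\mathrm o}(\xi_0)),\mathrm{row}(D_{\mathrm{o}u}(\xi_0))]^T[\mathrm{row}(C_{\mathrm o}(\xi_0)),\mathrm{row}(D_{\mathrm{o}u}(\xi_0))]\big],$$ $$\bar B_{\mathrm{o}w}^T\bar B_{\mathrm{o}w}=E\big[\mathrm{row}(B_{\mathrm{o}w}(\xi_0))^T\mathrm{row}(B_{\mathrm{o}w}(\xi_0))\big].$$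 Partition them as $\bar G_{AB}=[\bar A_{\mathrm{o}1},\ldots,\bar A_{\mathrm{o}n},\bar B_{\mathrm{o}u1},\ldots,\bar B_{\mathrm{o}un}]$ with $\bar A_{\mathrm{o}i}\in\mathbf{R}^{\bar n_u\times n}$, $\bar B_{\mathrm{o}ui}\in\mathbf{R}^{\bar n_u\times p_u}$ ($i=1,\ldots,n$); $\bar G_{CD}=[\bar C_{\mathrm{o}1},\ldots,\bar C_{\mathrm{o}q_z},\bar D_{\mathrm{o}u1},\ldots,\bar D_{\mathrm{o}uq_z}]$ with $\bar C_{\mathrm{o}i}\in\mathbf{R}^{\bar q_{zu}\times n}$, $\bar D_{\mathrm{o}ui}\in\mathbf{R}^{\bar q_{zu}\times p_u}$ ($i=1,\ldots,q_z$); $\bar B_{\mathrm{o}w}=[\bar B_{\mathrm{o}w1},\ldots,\bar B_{\mathrm{o}wn}]$ with $\bar B_{\mathrm{o}wi}\in\mathbf{R}^{\bar p_w\times p_w}$ ($i=1,\ldots,n$). Then $\widetilde A_{\mathrm o}:=[\bar A_{\mathrm{o}1}^T,\ldots,\bar A_{\mathrm{o}n}^T]^T\in\mathbf{R}^{n\bar n_u\times n}$, $\widetilde B_{\mathrm{o}u}:=[\bar B_{\mathrm{o}u1}^T,\ldots,\bar B_{\mathrm{o}un}^T]^T\in\mathbf{R}^{n\bar n_u\times p_u}$, $\widetilde C_{\mathrm o}:=[\bar C_{\mathrm{o}1}^T,\ldots,\bar C_{\mathrm{o}q_z}^T]^T\in\mathbf{R}^{q_z\bar q_{zu}\times n}$,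 $\widetilde D_{\mathrm{o}u}:=[\bar D_{\mathrm{o}u1}^T,\ldots,\bar D_{\mathrm{o}uq_z}^T]^T\in\mathbf{R}^{q_z\bar q_{zu}\times p_u}$, $\widetilde B_{\mathrm{o}w}:=[\bar B_{\mathrm{o}w1}^T,\ldots,\bar B_{\mathrm{o}wn}^T]^T\in\mathbf{R}^{n\bar p_w\times p_w}$. Closed-loop system. $G_F$ is the system $x_{k+1}=A(\xi_k)x_k+B(\xi_k)w_k$, $z_k=C(\xi_k)x_k+D(\xi_k)w_k$ with $A=A_{\mathrm o}+B_{\mathrm{o}u}F$, $B=B_{\mathrm{o}w}$, $C=C_{\mathrm o}+D_{\mathrm{o}u}F$, $D=D_{\mathrm{o}w}$. Exponential stability in the second moment: a system $G$ of the form $x_{k+1}=A(\xi_k)x_k+B(\xi_k)w_k$, $z_k=C(\xi_k)x_k+D(\xi_k)w_k$ is exponentially stable in the second moment if, for $w\equiv0$, there exist $a>0$ and $\lambda\in(0,1)$ such that $\sqrt{E[\|x_k\|^2]}\le a\|x_0\|\lambda^k$ for all $k\in\mathbf{N}_0$ and all $x_0\in\mathbf{R}^n$, where $\|\cdot\|$ is the Euclidean norm. $H_2$ norm: for such a $G$ that is exponentially stable in the second moment, $\|G\|_2:=\sqrt{s_\infty}$, where $s_\infty=\lim_{K\to\infty}s_K$ (this limit exists and is finite for such $G$), $$s_K:=E\left[\mathrm{tr}\left(D(\xi_0)^TD(\xi_0)\right)\right]+\sum_{k=1}^K E\left[\mathrm{tr}\left(B(\xi_0)^T(\Phi_1^k)^TC(\xi_k)^TC(\xi_k)\Phi_1^kB(\xi_0)\right)\right],$$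 and $\Phi_{k_1}^{k_2}:=I$ if $k_2=k_1$, $\Phi_{k_1}^{k_2}:=A(\xi_{k_2-1})A(\xi_{k_2-2})\cdots A(\xi_{k_1})$ if $k_2\ge k_1+1$. *)

(* Defs.v *)
From mathcomp Require Import all_boot all_order all_algebra.
From mathcomp Require Import all_classical all_reals all_analysis.
From mathcomp Require Import mxtens. (* Kronecker product [A *t B] *)

Set Implicit Arguments.
Unset Strict Implicit.
Unset Printing Implicit Defensive.

Import Order.TTheory GRing.Theory Num.Theory.
Import numFieldNormedType.Exports.

Local Open Scope classical_set_scope.
Local Open Scope ring_scope.

Section Matrices.
Context {R : realType}.

Definition posdefmx n (M : 'M[R]_n) : Prop :=
  M^T = M /\ forall x : 'cV[R]_n, x != 0 -> 0 < (x^T *m M *m x) 0 0.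

Definition enorm n (x : 'cV[R]_n) : R := Num.sqrt (\sum_i x i 0 ^+ 2).

(* [[M1, *], [M21, M2]], where * is the transpose of the opposite block. *)
Definition symblock m1 m2 (M1 : 'M[R]_m1) (M21 : 'M[R]_(m2, m1))
    (M2 : 'M[R]_m2) : 'M[R]_(m1 + m2) := block_mx M1 M21^T M21 M2.

(* For G = [G_1, ..., G_m] with blocks G_i of size q x p, [colblock G i] is G_i
   and [restack G] is the column of blocks [G_1^T, ..., G_m^T]^T.
   [mxvec_index] numbers columns block by block, just as [mxvec M] is row(M);
   [mxtens_unindex] sends row number i * q + a to (i, a). *)
Definition colblock m p q (G : 'M[R]_(q, m * p)) (i : 'I_m) : 'M[R]_(q, p) :=
  \matrix_(a, j) G a (mxvec_index i j).

Definition restack m p q (G : 'M[R]_(q, m * p)) : 'M[R]_(m * q, p) :=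
  \matrix_(r, j) colblock G (mxtens_unindex r).1 (mxtens_unindex r).2 j.

End Matrices.

Section Probability.
Context {d : measure_display} {Omega : measurableType d} {R : realType}.
Variable P : probability Omega R.

(* T equipped with its Borel sigma-algebra. *)
Definition borel (T : ptopologicalType) := g_sigma_algebraType (@open T).

Definition random_vector Z (X : Omega -> 'cV[R]_Z) : Prop :=
  measurable_fun setT (X : Omega -> borel 'cV[R]_Z).

Definition independent_seq Z (xi : nat -> Omega -> 'cV[R]_Z) : Prop :=
  forall (J : seq nat) (B : nat -> set (borel 'cV[R]_Z)),
    uniq J -> (forall k, measurable (B k)) ->
    P (\bigcap_(k in [set` J]) (xi k @^-1` B k)) =
    (\prod_(k <- J) P (xi k @^-1` B k))%E.

Definition identically_distributed Z (xi : nat -> Omega -> 'cV[R]_Z) : Prop :=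
  forall (k l : nat) (B : set (borel 'cV[R]_Z)), measurable B ->
    P (xi k @^-1` B) = P (xi l @^-1` B).

(* The support of the law of X: the smallest closed set of full measure. *)
Definition law_support Z (X : Omega -> 'cV[R]_Z) : set 'cV[R]_Z :=
  [set x | forall U : set 'cV[R]_Z, open U -> U x -> (0 < P (X @^-1` U))%E].

(* Entrywise expectation; meant for matrices with integrable entries. *)
Definition Emx m p (M : Omega -> 'M[R]_(m, p)) : 'M[R]_(m, p) :=
  \matrix_(i, j) fine 'E_P[fun w => M w i j].

Definition square_integrable m p (M : Omega -> 'M[R]_(m, p)) : Prop :=
  forall i j, P.-integrable setT (fun w => (M w i j ^+ 2)%:E).

(* Second moment matrix of a random row vector. *)
Definition second_moment m (r : Omega -> 'rV[R]_m) : 'M[R]_m :=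
  Emx (fun w => (r w)^T *m r w).

End Probability.

Section Systems.
Context {R : realType}.

(* x_{k+1} = A(xi_k) x_k + B(xi_k) w_k,  z_k = C(xi_k) x_k + D(xi_k) w_k *)
Record system (Z n pw qz : nat) := System {
  sysA : 'cV[R]_Z -> 'M[R]_n;
  sysB : 'cV[R]_Z -> 'M[R]_(n, pw);
  sysC : 'cV[R]_Z -> 'M[R]_(qz, n);
  sysD : 'cV[R]_Z -> 'M[R]_(qz, pw) }.

(* The coefficient functions of a plant are defined on Xi only. *)
Record plant (Z n pw pu qz : nat) (Xi : set 'cV[R]_Z) := Plant {
  coefA  : Xi -> 'M[R]_n;
  coefBw : Xi -> 'M[R]_(n, pw);
  coefBu : Xi -> 'M[R]_(n, pu);
  coefC  : Xi -> 'M[R]_(qz, n);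
  coefDw : Xi -> 'M[R]_(qz, pw);
  coefDu : Xi -> 'M[R]_(qz, pu) }.

(* Extension by 0 outside Xi, so that f(xi_k) is defined on the whole sample
   space; the value chosen is immaterial when xi_k lies in Xi almost surely. *)
Definition ext0 Z (Xi : set 'cV[R]_Z) m p (f : Xi -> 'M[R]_(m, p))
    (x : 'cV[R]_Z) : 'M[R]_(m, p) := oapp f 0 (insub x).

(* f : Xi -> R^{m x p} is Borel. *)
Definition borel_on Z (Xi : set 'cV[R]_Z) m p (f : Xi -> 'M[R]_(m, p)) : Prop :=
  measurable_fun (Xi : set (borel 'cV[R]_Z))
    (ext0 f : borel 'cV[R]_Z -> borel 'M[R]_(m, p)).

Section Plant.
Context {Z n pw pu qz : nat} {Xi : set 'cV[R]_Z}.
Variable G : plant n pw pu qz Xi.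

Definition Ao := ext0 (coefA G).
Definition Bow := ext0 (coefBw G).
Definition Bou := ext0 (coefBu G).
Definition Co := ext0 (coefC G).
Definition Dow := ext0 (coefDw G).
Definition Dou := ext0 (coefDu G).

Definition borel_plant : Prop :=
  [/\ borel_on (coefA G), borel_on (coefBw G) & borel_on (coefBu G)] /\
  [/\ borel_on (coefC G), borel_on (coefDw G) & borel_on (coefDu G)].

(* Loop closed by the state feedback u_k = F x_k. *)
Definition closed_loop (F : 'M[R]_(pu, n)) : system Z n pw qz :=
  System (fun x => Ao x + Bou x *m F) Bow (fun x => Co x + Dou x *m F) Dow.

End Plant.

Section Trajectories.
Context {d : measure_display} {Omega : measurableType d}.
Variable P : probability Omega R.
Context {Z n pw pu qz : nat}.
Variable xi : nat -> Omega -> 'cV[R]_Z.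

Definition square_integrable_plant (Xi : set 'cV[R]_Z)
    (G : plant n pw pu qz Xi) : Prop :=
  [/\ square_integrable P (Ao G \o xi 0%N),
      square_integrable P (Bow G \o xi 0%N) &
      square_integrable P (Bou G \o xi 0%N)] /\
  [/\ square_integrable P (Co G \o xi 0%N),
      square_integrable P (Dow G \o xi 0%N) &
      square_integrable P (Dou G \o xi 0%N)].

Variable S : system Z n pw qz.

Fixpoint state (x0 : 'cV[R]_n) (v : nat -> Omega -> 'cV[R]_pw) (k : nat)
    (w : Omega) : 'cV[R]_n :=
  if k is k'.+1 then
    sysA S (xi k' w) *m state x0 v k' w + sysB S (xi k' w) *m v k' w
  else x0.

Definition exp_stable2 : Prop :=
  exists a lambda : R, [/\ 0 < a, 0 < lambda, lambda < 1 &
    forall (k : nat) (x0 : 'cV[R]_n),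
      (sqrte 'E_P[fun w => (enorm (state x0 (fun _ _ => 0) k w) ^+ 2)%R]
        <= (a * enorm x0 * lambda ^+ k)%:E)%E].

(* [transition k m] is Phi_k^{k+m} = A(xi_{k+m-1}) ... A(xi_k). *)
Fixpoint transition (k m : nat) (w : Omega) : 'M[R]_n :=
  if m is m'.+1 then sysA S (xi (k + m')%N w) *m transition k m' w
  else 1%:M.

Definition Phi (k1 k2 : nat) : Omega -> 'M[R]_n := transition k1 (k2 - k1).

Definition h2sum (K : nat) : \bar R :=
  ('E_P[fun w => \tr ((sysD S (xi 0%N w))^T *m sysD S (xi 0%N w))] +
   \sum_(1 <= k < K.+1)
     'E_P[fun w => \tr ((sysB S (xi 0%N w))^T *m (Phi 1 k w)^T *m
                        (sysC S (xi k w))^T *m sysC S (xi k w) *m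
                        Phi 1 k w *m sysB S (xi 0%N w))])%E.

Definition h2norm : \bar R := sqrte (limn h2sum).

End Trajectories.

Section ConstantMatrices.
Context {d : measure_display} {Omega : measurableType d}.
Variable P : probability Omega R.
Context {Z n pw pu qz : nat} {Xi : set 'cV[R]_Z}.
Variables (xi : nat -> Omega -> 'cV[R]_Z) (G : plant n pw pu qz Xi).

(* The widths n * n + n * pu and qz * n + qz * pu are (n + pu) n and
   (n + pu) qz, split according to [row(A_o), row(B_ou)], resp.
   [row(C_o), row(D_ou)]. *)
Definition factorAB nu (GAB : 'M[R]_(nu, n * n + n * pu)) : Prop :=
  GAB^T *m GAB = second_moment P
    (fun w => row_mx (mxvec (Ao G (xi 0%N w))) (mxvec (Bou G (xi 0%N w)))).

Definition factorCD qzu (GCD : 'M[R]_(qzu, qz * n + qz * pu)) : Prop :=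
  GCD^T *m GCD = second_moment P
    (fun w => row_mx (mxvec (Co G (xi 0%N w))) (mxvec (Dou G (xi 0%N w)))).

Definition factorBw rw (GBw : 'M[R]_(rw, n * pw)) : Prop :=
  GBw^T *m GBw = second_moment P (fun w => mxvec (Bow G (xi 0%N w))).

Definition E_D : 'M[R]_pw :=
  Emx P (fun w => (Dow G (xi 0%N w))^T *m Dow G (xi 0%N w)).

End ConstantMatrices.

Section LMI.
Context {n pw pu qz nu qzu rw : nat}.
Variables (GAB : 'M[R]_(nu, n * n + n * pu)).
Variables (GCD : 'M[R]_(qzu, qz * n + qz * pu)).
Variables (GBw : 'M[R]_(rw, n * pw)).

Definition tA : 'M[R]_(n * nu, n) := restack (lsubmx GAB).
Definition tBu : 'M[R]_(n * nu, pu) := restack (rsubmx GAB).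
Definition tC : 'M[R]_(qz * qzu, n) := restack (lsubmx GCD).
Definition tDu : 'M[R]_(qz * qzu, pu) := restack (rsubmx GCD).
Definition tBw : 'M[R]_(n * rw, pw) := restack GBw.

Definition lmi_stab (X : 'M[R]_n) (Y : 'M[R]_(pu, n)) :=
  symblock
    (symblock X (tA *m X + tBu *m Y) (X *t (1%:M : 'M[R]_nu)))
    (row_mx (tC *m X + tDu *m Y) 0)
    (1%:M : 'M[R]_(qz * qzu)).

Definition lmi_perf (X : 'M[R]_n) (S ED : 'M[R]_pw) :=
  symblock (S - ED) tBw (X *t (1%:M : 'M[R]_rw)).

Definition lmi_sol (ED : 'M[R]_pw) (gamma : R)
    (X : 'M[R]_n) (Y : 'M[R]_(pu, n)) (S : 'M[R]_pw) : Prop :=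
  [/\ posdefmx X, S^T = S, posdefmx (lmi_stab X Y),
      posdefmx (lmi_perf X S ED) & \tr S < gamma ^+ 2].

End LMI.
End Systems.

(* Main.v *)
(* Let T(V) = E[A^T V A] for the closed-loop A. Since the xi_k are i.i.d., A(xi_k)
   is independent of x_k, so E|x_k|^2 = x_0^T T^k(I) x_0, and the k-th term of the
   H_2 sum is tr E[B^T T^(k-1)(C^T C) B]. The factors of the second moment matrices
   give T(V) = A~^T (V (x) I) A~, so for W = X^-1 two Schur complements turn the LMIs
   into W - T(W) - E[C^T C] > 0 and R - E_D - E[B^T W B] > 0.

   If these hold then T(W) <= (1 - mu) W for some mu > 0, which gives stability, and
   the H_2 sum telescopes against W - T(W). Conversely, a long enough partial sum of
   sum_k T^k(E[C^T C] + e I) is an admissible W when e > 0 is small.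

   Independence enters through expectations of products of functions of the single
   xi_j only, so it suffices to extend the product rule from indicators to nonnegative
   functions one factor at a time. *)

Require Import Defs.
From HB Require Import structures.
From mathcomp Require Import all_boot all_order all_algebra.
From mathcomp Require Import all_classical all_reals all_analysis.
From mathcomp Require Import measurable_realfun mxtens ring lra.
Import Order.TTheory GRing.Theory Num.Theory.
Import numFieldNormedType.Exports.
Local Open Scope classical_set_scope.
Local Open Scope ring_scope.

(** * Quadratic forms and Schur complements *)

Section QuadraticForms.
Set Implicit Arguments.
Unset Strict Implicit.
Context {R : realType}.

(** Symmetry is not part of the notion, so sums and congruences preserve it with nothing else to
    check; symmetry is tracked separately where it is wanted. *)
Definition psdmx n (M : 'M[R]_n) : Prop := forall x : 'cV[R]_n, 0 <= (x^T *m M *m x) 0 0.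

Lemma posdefmx_psd n (M : 'M[R]_n) : posdefmx M -> psdmx M.
Proof.
case=> _ M_gt0 x; have [->|x0] := eqVneq x 0; first by rewrite mulmx0 mxE.
exact/ltW/M_gt0.
Qed.

Lemma psdmxD n (M N : 'M[R]_n) : psdmx M -> psdmx N -> psdmx (M + N).
Proof. by move=> M0 N0 x; rewrite mulmxDr mulmxDl mxE addr_ge0. Qed.

Lemma psdmxZ n (a : R) (M : 'M[R]_n) : 0 <= a -> psdmx M -> psdmx (a *: M).
Proof. by move=> a0 M0 x; rewrite -scalemxAr -scalemxAl mxE mulr_ge0. Qed.

Lemma psdmx0 n : psdmx (0 : 'M[R]_n).
Proof. by move=> x; rewrite mulmx0 mul0mx mxE. Qed.

Lemma psdmx_conj m n (A : 'M[R]_(m, n)) (M : 'M[R]_m) : psdmx M -> psdmx (A^T *m M *m A).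
Proof. by move=> M0 x; have := M0 (A *m x); rewrite trmx_mul !mulmxA. Qed.

Let addmxE m n (A B : 'M[R]_(m, n)) i j : (A + B) i j = A i j + B i j.
Proof. by rewrite mxE. Qed.

Let oppmxE m n (A : 'M[R]_(m, n)) i j : (- A) i j = - A i j.
Proof. by rewrite mxE. Qed.

Let scalemxE m n a (A : 'M[R]_(m, n)) i j : (a *: A) i j = a * A i j.
Proof. by rewrite mxE. Qed.

Lemma dotcolE n (x : 'cV[R]_n) : (x^T *m x) 0 0 = \sum_i x i 0 ^+ 2.
Proof. by rewrite mxE; apply: eq_bigr => i _; rewrite mxE expr2. Qed.

Lemma dotcol_ge0 n (x : 'cV[R]_n) : 0 <= (x^T *m x) 0 0.
Proof. by rewrite dotcolE sumr_ge0 // => i _; exact: sqr_ge0. Qed.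

Lemma dotcol_gt0 n (x : 'cV[R]_n) : x != 0 -> 0 < (x^T *m x) 0 0.
Proof.
move=> x0; rewrite lt_def dotcol_ge0 andbT dotcolE psumr_eq0; last by move=> i _; exact: sqr_ge0.
apply: contra x0 => /allP x0; apply/eqP/matrixP => i j; rewrite mxE ord1; apply/eqP.
by rewrite -sqrf_eq0; apply: x0; rewrite mem_index_enum.
Qed.

Lemma psdmx1 n : psdmx (1%:M : 'M[R]_n).
Proof. by move=> x; rewrite mulmx1 dotcol_ge0. Qed.

Lemma posdefmx_pert n (M N : 'M[R]_n) : posdefmx M -> N^T = N -> psdmx N -> posdefmx (M + N).
Proof.
move=> [Ms M0] Ns N0; split; first by rewrite linearD /= Ms Ns.
by move=> x x0; rewrite mulmxDr mulmxDl mxE ltr_pwDl // M0.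
Qed.

Lemma posdefmx_scalar n (a : R) : 0 < a -> posdefmx (a%:M : 'M[R]_n).
Proof.
move=> a0; split; first exact: tr_scalar_mx.
by move=> x x0; rewrite mul_mx_scalar -scalemxAl mxE mulr_gt0 // dotcol_gt0.
Qed.

Lemma psd_trace n (M : 'M[R]_n) : psdmx M -> 0 <= \tr M.
Proof.
move=> M0; apply: sumr_ge0 => i _; have := M0 (delta_mx i 0).
by rewrite trmx_delta -rowE -colE !mxE.
Qed.

Lemma posdefmx_unit n (M : 'M[R]_n) : posdefmx M -> M \in unitmx.
Proof.
move=> [Ms M0]; rewrite unitmxE unitfE; apply/negP => /det0P [v v0 vM].
have := M0 v^T; rewrite trmxK vM mul0mx mxE ltxx => /(_ _).
by case/(_ _)/notF; rewrite trmx_eq0.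
Qed.

Lemma posdefmx_inv n (M : 'M[R]_n) : posdefmx M -> posdefmx (invmx M).
Proof.
move=> Mp; have Mu := posdefmx_unit Mp; case: Mp => Ms M0; split; first by rewrite trmx_inv Ms.
move=> x x0; have := M0 (invmx M *m x).
rewrite trmx_mul trmx_inv Ms mulmxKV  // -(mulmxA _ (invmx M) x); apply.
by apply: contraNneq x0 => e; rewrite -(mulKVmx Mu x) e mulmx0.
Qed.

(** Discriminant argument: the form at x - t y is a nonnegative quadratic polynomial in t with
    leading coefficient c, minimal at t = b / c. If c = 0 it is affine in t, and nonnegativity
    forces b = 0. *)
Lemma psdmx_cauchy n (M : 'M[R]_n) (x y : 'cV[R]_n) : M^T = M -> psdmx M ->
  (y^T *m M *m x) 0 0 ^+ 2 <= (y^T *m M *m y) 0 0 * (x^T *m M *m x) 0 0.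
Proof.
move=> Ms M0; set b := (y^T *m M *m x) 0 0; set c := (y^T *m M *m y) 0 0.
set a := (x^T *m M *m x) 0 0.
have bE : (x^T *m M *m y) 0 0 = b.
  by rewrite /b -[in RHS](trmxK (y^T *m M *m x)) [RHS]mxE !trmx_mul trmxK Ms mulmxA.
have E t : 0 <= a - 2 * t * b + t ^+ 2 * c.
  have := M0 (x - t *: y); rewrite mulmxBr [trmx _]linearB /= [(t *: y)^T]linearZ /= !mulmxBl.
  rewrite -!(scalemxAl, scalemxAr) !(addmxE, oppmxE, scalemxE) bE -/a -/b -/c.
  lra.
have c0 : 0 <= c := M0 y.
have [c_eq0|cn0] := eqVneq c 0.
  rewrite c_eq0 mul0r; have [->|bn0] := eqVneq b 0; first by rewrite expr0n.
  (* This t would give the polynomial the value -1. *)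
  have := E ((a + 1) / (2 * b)); rewrite c_eq0 mulr0 addr0.
  have -> : 2 * ((a + 1) / (2 * b)) * b = a + 1 by field.
  lra.
have cp : 0 < c by rewrite lt_def cn0.
have := E (b / c).
have -> : a - 2 * (b / c) * b + (b / c) ^+ 2 * c = a - b ^+ 2 / c by field.
by rewrite subr_ge0 ler_pdivrMr // mulrC.
Qed.

(** Since x_i = (M^-1 e_i)^T M x, Cauchy-Schwarz for the form M gives x_i^2 <= (M^-1)_ii x^T M x;
    summing over i produces the trace. *)
Lemma posdefmx_dot_le n (M : 'M[R]_n) (x : 'cV[R]_n) : posdefmx M ->
  (x^T *m x) 0 0 <= \tr (invmx M) * (x^T *m M *m x) 0 0.
Proof.
move=> Mp; have Mu := posdefmx_unit Mp; have [Ms _] := Mp.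
rewrite dotcolE /mxtrace mulr_suml; apply: ler_sum => i _.
have := @psdmx_cauchy _ M x (invmx M *m delta_mx i 0) Ms (posdefmx_psd Mp).
rewrite trmx_mul trmx_inv Ms mulmxKV // trmx_delta -!rowE -colE !mxE.
by apply.
Qed.

Lemma quad_le_dot n (V : 'M[R]_n) : exists2 c, 0 <= c &
  forall x : 'cV[R]_n, (x^T *m V *m x) 0 0 <= c * (x^T *m x) 0 0.
Proof.
(* A crude constant is enough, because |x_i x_j| <= x^T x for all i and j. *)
exists (\sum_i \sum_j `|V i j|); first by apply: sumr_ge0 => i _; apply: sumr_ge0.
move=> x; rewrite -mulmxA mxE mulr_suml; apply: ler_sum => i _.
rewrite !mxE mulr_sumr mulr_suml; apply: ler_sum => j _.
have le k : x k 0 ^+ 2 <= (x^T *m x) 0 0.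
  by rewrite dotcolE (bigD1 k) //= lerDl sumr_ge0 // => l _; exact: sqr_ge0.
have xij : `|x i 0 * x j 0| <= (x^T *m x) 0 0.
  rewrite normrM -(@ler_pXn2r _ 2) ?nnegrE ?mulr_ge0 ?dotcol_ge0 //.
  by rewrite exprMn -!normrX !ger0_norm ?sqr_ge0 // [leRHS]expr2 ler_pM ?sqr_ge0.
rewrite (le_trans (ler_norm _)) // mulrCA normrM ler_wpM2l //; move: xij; rewrite mxE; apply.
Qed.

Lemma posdefmx_absorb n (M V : 'M[R]_n) : posdefmx M ->
  exists2 mu, 0 < mu <= 2^-1 &
  forall x : 'cV[R]_n, mu * (x^T *m V *m x) 0 0 <= (x^T *m M *m x) 0 0.
Proof.
move=> Mp; have [c c0 Vc] := quad_le_dot V.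
set t := \tr (invmx M).
have t0 : 0 <= t by exact/psd_trace/posdefmx_psd/posdefmx_inv.
have ct : 0 <= c * t by rewrite mulr_ge0.
(* As forms V <= c I <= c t M, so mu c t <= 1 suffices. The summand 2 makes mu at most 1/2, which
   keeps the later rate 1 - mu positive. *)
exists (c * t + 2)^-1.
  by rewrite invr_gt0 lef_pV2 ?posrE; lra.
move=> x; rewrite mulrC ler_pdivrMr; last lra.
rewrite (le_trans (Vc x)) //.
have h := ler_wpM2l c0 (posdefmx_dot_le x Mp).
have := posdefmx_psd Mp x => q0.
rewrite (le_trans h) // -/t; nra.
Qed.

Lemma symblock_sym m1 m2 (M1 : 'M[R]_m1) (M21 : 'M[R]_(m2, m1)) (M2 : 'M[R]_m2) :
  (symblock M1 M21 M2)^T = symblock M1 M21 M2 <-> M1^T = M1 /\ M2^T = M2.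
Proof.
rewrite /symblock tr_block_mx trmxK; split=> [/eq_block_mx[-> _ _ ->] //|[-> ->] //].
Qed.

(** Completing the square in y, with [N2] the inverse of [M2]. *)
Lemma symblock_form m1 m2 (M1 : 'M[R]_m1) (M21 : 'M[R]_(m2, m1)) (M2 N2 : 'M[R]_m2)
    (x : 'cV[R]_m1) (y : 'cV[R]_m2) : M2^T = M2 -> M2 *m N2 = 1%:M ->
  ((col_mx x y)^T *m symblock M1 M21 M2 *m col_mx x y) 0 0 =
  (x^T *m (M1 - M21^T *m N2 *m M21) *m x) 0 0 +
  ((y + N2 *m M21 *m x)^T *m M2 *m (y + N2 *m M21 *m x)) 0 0.
Proof.
move=> s2 N2E; have N2E' : N2 *m M2 = 1%:M by exact: mulmx1C.
have N2T : N2^T *m M2 = 1%:M by rewrite -[M2]s2 -trmx_mul N2E trmx1.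
rewrite /symblock tr_col_mx mul_row_block mul_row_col [(y + _)^T]linearD /= !trmx_mul.
rewrite mulmxBr mulmxBl !mulmxDl !mulmxDr !mulmxA.
rewrite -(mulmxA _ N2^T M2) N2T mulmx1 -(mulmxA _ M2 N2) N2E mulmx1.
by rewrite !(addmxE, oppmxE); ring.
Qed.

(** The inverse of the corner is passed as [N2], so that the inverse of a Kronecker product can be
    supplied in closed form. Both directions are read off the completed square. *)
Lemma posdefmx_schur m1 m2 (M1 : 'M[R]_m1) (M21 : 'M[R]_(m2, m1)) (M2 N2 : 'M[R]_m2) :
  M2 *m N2 = 1%:M ->
  posdefmx (symblock M1 M21 M2) <->
  posdefmx M2 /\ posdefmx (M1 - M21^T *m N2 *m M21).
Proof.
move=> N2E.
have symE : M2^T = M2 -> (M1^T = M1 <-> (M1 - M21^T *m N2 *m M21)^T = M1 - M21^T *m N2 *m M21).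
  move=> s2; have sN : N2^T = N2.
    have : N2^T *m M2 = 1%:M by rewrite -[M2]s2 -trmx_mul N2E trmx1.
    by move=> e; rewrite -[N2^T]mulmx1 -N2E mulmxA e mul1mx.
  rewrite linearB /= !trmx_mul trmxK sN mulmxA; split=> [-> //|].
  by move/addIr.
split.
- case=> /symblock_sym [s1 s2] p; split; split=> //.
  + move=> y y0; have := p (col_mx 0 y); rewrite (symblock_form _ _ _ _ s2 N2E).
    rewrite !(mulmx0, mul0mx, trmx0, addr0) mxE add0r; apply.
    by rewrite col_mx_eq0 negb_and y0 orbT.
  + exact/symE.
  (* This lower part makes the completed square vanish and leaves the Schur complement at x. *)
  + move=> x x0; have := p (col_mx x (- (N2 *m M21 *m x))).
    rewrite (symblock_form _ _ _ _ s2 N2E) addNr mulmx0 [X in _ + X]mxE addr0; apply.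
    by rewrite col_mx_eq0 negb_and x0.
- case=> [p2 p1]; have [s2 q2] := p2; have [s1 q1] := p1; split.
    by apply/symblock_sym; split=> //; apply/symE.
  move=> v; rewrite -[v]vsubmxK; move: (usubmx v) (dsubmx v) => x y.
  rewrite col_mx_eq0 negb_and (symblock_form _ _ _ _ s2 N2E).
  have [->|x0 _] := eqVneq x 0 => /= [y0|].
    by rewrite !(mulmx0, mul0mx, trmx0, addr0) mxE add0r q2.
  by rewrite ltr_pwDl ?q1 // posdefmx_psd.
Qed.

End QuadraticForms.

(** * Discrete Lyapunov inequalities *)

Section Lyapunov.
Set Implicit Arguments.
Unset Strict Implicit.
Context {R : realType}.

Let qformB n (M N : 'M[R]_n) (x : 'cV[R]_n) :
  (x^T *m (M - N) *m x) 0 0 = (x^T *m M *m x) 0 0 - (x^T *m N *m x) 0 0.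
Proof. by rewrite mulmxBr mulmxBl !mxE. Qed.

Let qformZ n a (M : 'M[R]_n) (x : 'cV[R]_n) :
  (x^T *m (a *: M) *m x) 0 0 = a * (x^T *m M *m x) 0 0.
Proof. by rewrite -scalemxAr -scalemxAl mxE. Qed.

Lemma psdmxBE n (M N : 'M[R]_n) : psdmx (N - M) <->
  forall x : 'cV[R]_n, (x^T *m M *m x) 0 0 <= (x^T *m N *m x) 0 0.
Proof. by split=> h x; have := h x; rewrite qformB subr_ge0. Qed.

Lemma psdmx_sum n K (M : nat -> 'M[R]_n) :
  (forall k, psdmx (M k)) -> psdmx (\sum_(k < K) M k).
Proof. by move=> M0; elim/big_ind: _ => [|? ?|? _]; [exact: psdmx0|exact: psdmxD|]. Qed.

Variable n : nat.
(** Abstract form of V |-> E[A^T V A]: linear and preserving nonnegative forms, hence monotone. *)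
Variable T : {linear 'M[R]_n -> 'M[R]_n}.
Hypothesis T_psd : forall V, psdmx V -> psdmx (T V).

Lemma iter_psd k V : psdmx V -> psdmx (iter k T V).
Proof. by move=> V0; elim: k => //= k; exact: T_psd. Qed.

Lemma iter_linearB k V U : iter k T (V - U) = iter k T V - iter k T U.
Proof. by elim: k => //= k ->; rewrite linearB. Qed.

Lemma iter_linearD k V U : iter k T (V + U) = iter k T V + iter k T U.
Proof. by elim: k => //= k ->; rewrite linearD. Qed.

Lemma iter_linearZ k a V : iter k T (a *: V) = a *: iter k T V.
Proof. by elim: k => //= k ->; rewrite linearZ. Qed.

Lemma iter_mono k V U : psdmx (U - V) -> psdmx (iter k T U - iter k T V).
Proof. by move=> h; rewrite -iter_linearB; exact: iter_psd. Qed.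

Lemma sum_iter_telescope K V :
  \sum_(k < K) iter k T (V - T V) = V - iter K T V.
Proof.
elim: K => [|K IH]; first by rewrite big_ord0 subrr.
by rewrite big_ord_recr /= IH iter_linearB -iterSr /= addrA subrK.
Qed.

(** By telescoping, the gap equals T^K W plus the sum of T^k (W - T W - Q) for k < K, and all these
    terms are nonnegative forms. This is what bounds the partial H_2 sums. *)
Lemma lyapunov_sum_le K W Q : psdmx W -> psdmx (W - T W - Q) ->
  psdmx (W - \sum_(k < K) iter k T Q).
Proof.
move=> W0 h.
have -> : W - \sum_(k < K) iter k T Q =
    iter K T W + \sum_(k < K) iter k T (W - T W - Q).
  under [in RHS]eq_bigr do rewrite iter_linearB.
  rewrite sumrB sum_iter_telescope addrA; congr (_ - _).
  by rewrite addrC subrK.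
by apply: psdmxD; [exact: iter_psd|apply: psdmx_sum => k; exact: iter_psd].
Qed.

(** The strict slack dominates mu W, so T W <= (1 - mu) W and T^k W decays geometrically. Comparing
    I with W in both directions turns this into decay of T^k I. *)
Lemma lyapunov_stable W Q : posdefmx W -> psdmx Q -> posdefmx (W - T W - Q) ->
  exists a lambda : R, [/\ 0 < a, 0 < lambda, lambda < 1 &
    forall k (x : 'cV[R]_n),
      (x^T *m iter k T 1%:M *m x) 0 0 <= (a * lambda ^+ k) ^+ 2 * (x^T *m x) 0 0].
Proof.
move=> Wp Q0 Mp; have [mu /andP[mu0 mu2] muP] := posdefmx_absorb W Mp.
have W0 := posdefmx_psd Wp.
have [w w0 wP] := quad_le_dot W.
set t := \tr (invmx W).
have t0 : 0 <= t by exact/psd_trace/posdefmx_psd/posdefmx_inv.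
set r := 1 - mu; have r0 : 0 < r by rewrite /r; lra.
have r1 : r < 1 by rewrite /r; lra.
have TW : psdmx (r *: W - T W).
  apply/psdmxBE => x; have := muP x; rewrite qformZ !qformB.
  by have := Q0 x; rewrite /r; lra.
have TkW k : psdmx (r ^+ k *: W - iter k T W).
  elim: k => [|k IH]; first by rewrite expr0 scale1r subrr; exact: psdmx0.
  (* The difference r^(k+1) W - T^(k+1) W is split into r^k (r W - T W) and T (r^k W - T^k W). *)
  rewrite -[_ - _](subrKA (r ^+ k *: T W)).
  apply: psdmxD; last by rewrite -linearZ -linearB; exact: T_psd.
  by rewrite exprSr -scalerA -scalerBr; apply: psdmxZ => //; rewrite exprn_ge0 // ltW.
have IW : psdmx (t *: W - 1%:M).
  by apply/psdmxBE => x; rewrite qformZ mulmx1; exact: posdefmx_dot_le.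
(* From I <= t W and W <= w I one gets T^k I <= t w r^k I. Adding 1 keeps a positive, and the square
   roots appear because the claim squares a and lambda. *)
exists (Num.sqrt (t * w + 1)), (Num.sqrt r).
have tw : 0 <= t * w by rewrite mulr_ge0.
have tw1 : 0 < t * w + 1 by rewrite ltr_pwDr.
split; rewrite ?sqrtr_gt0 //.
  by move: r1; rewrite -(ltr_sqrt r ltr01) sqrtr1.
move=> k x; rewrite exprMn -exprM mulnC exprM !sqr_sqrtr ?(ltW tw1) ?(ltW r0) //.
have /psdmxBE/(_ x) := iter_mono k IW; rewrite iter_linearZ qformZ => /le_trans; apply.
have /psdmxBE/(_ x) := TkW k; rewrite qformZ => h1.
rewrite (le_trans (ler_wpM2l t0 h1)) //.
have rk0 : 0 <= r ^+ k by rewrite exprn_ge0 // ltW.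
have h2 : t * (x^T *m W *m x) 0 0 <= (t * w + 1) * (x^T *m x) 0 0.
  by have := ler_wpM2l t0 (wP x); have := dotcol_ge0 x; lra.
by have := ler_wpM2l rk0 h2; lra.
Qed.

Lemma geometric_sum_le (r : R) K : 0 <= r -> r < 1 ->
  \sum_(k < K) r ^+ k <= (1 - r)^-1.
Proof.
move=> r0 r1; rewrite -[leRHS]mul1r ler_pdivlMr ?subr_gt0 //.
suff -> : (\sum_(k < K) r ^+ k) * (1 - r) = 1 - r ^+ K.
  by rewrite gerBl exprn_ge0.
elim: K => [|K IH]; first by rewrite big_ord0 mul0r expr0 subrr.
by rewrite big_ord_recr /= mulrDl IH exprS; ring.
Qed.

(* A truncation of the series [\sum_k iter k T (Q + e I)] already solves the
   strict Lyapunov inequality, because the truncation error tends to 0 while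
   the slack [e I] does not. *)
Lemma lyapunov_exists p (S : {linear 'M[R]_n -> 'M[R]_p}) (Q : 'M[R]_n)
    (a lambda c s g : R) :
  (forall V, psdmx V -> psdmx (S V)) ->
  (forall V, V^T = V -> (T V)^T = T V) ->
  0 < lambda -> lambda < 1 ->
  (forall k (x : 'cV[R]_n),
      (x^T *m iter k T 1%:M *m x) 0 0 <= (a * lambda ^+ k) ^+ 2 * (x^T *m x) 0 0) ->
  Q^T = Q -> psdmx Q ->
  (forall K, c + \sum_(k < K) \tr (S (iter k T Q)) <= s) -> s < g ->
  exists P : 'M[R]_n, [/\ posdefmx P, posdefmx (P - T P - Q) & c + \tr (S P) < g].
Proof.
move=> S_psd T_sym l0 l1 stab Qs Q0 sP sg.
set r := lambda ^+ 2.
have r0 : 0 <= r by exact: sqr_ge0.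
have r1 : r < 1 by rewrite expr_lt1 // ltW.
have ak k : (a * lambda ^+ k) ^+ 2 = a ^+ 2 * r ^+ k.
  by rewrite exprMn /r -!exprM mulnC.
have TkI k : psdmx ((a ^+ 2 * r ^+ k)%:M - iter k T 1%:M).
  by apply/psdmxBE => x; rewrite mul_mx_scalar -scalemxAl [leRHS]mxE -ak.
set t := \tr (S 1%:M).
have t0 : 0 <= t by apply/psd_trace/S_psd/psdmx1.
set C := a ^+ 2 * t / (1 - r).
have C0 : 0 <= C by apply: divr_ge0; [rewrite mulr_ge0 // sqr_ge0|rewrite subr_ge0 ltW].
(* By stability the terms tr S(T^k I) are dominated by a geometric series with total C. *)
have sumI K : \sum_(k < K) \tr (S (iter k T 1%:M)) <= C.
  rewrite (@le_trans _ _ (\sum_(k < K) (a ^+ 2 * t) * r ^+ k)) //.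
    apply: ler_sum => k _; have := psd_trace (S_psd _ (TkI k)).
    rewrite linearB linearB /= -scalemx1 linearZ linearZ /= -/t subr_ge0.
    by rewrite mulrAC.
  rewrite -mulr_sumr; apply: ler_wpM2l; last exact: geometric_sum_le.
  by rewrite mulr_ge0 // sqr_ge0.
(* Adding e I to Q raises the cost by at most e C, which has to stay below the gap g - s; C + 1
   avoids a division by zero. *)
set e := (g - s) / (2 * (C + 1)).
have C1 : 0 < C + 1 by lra.
have e0 : 0 < e by rewrite divr_gt0 ?subr_gt0 // mulr_gt0.
have eC : e * C < g - s.
  have : e * (2 * (C + 1)) = g - s by rewrite /e divfK // mulf_neq0 // gt_eqF.
  nra.
have [q q0 qP] := quad_le_dot (Q + e%:M).
(* N is taken so large that the bound q a^2 r^N on the truncation error is below e. *)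
have [N NP] : exists N, q * a ^+ 2 * r ^+ N < e.
  have : (fun k => q * a ^+ 2 * r ^+ k) @ \oo --> (0 : R).
    rewrite -[X in _ --> X](mulr0 (q * a ^+ 2)); apply: cvgMr.
    by apply: cvg_expr; rewrite ger0_norm.
  move=> /cvgrPdist_lt /(_ e e0) [N _ /(_ N (leqnn N))] /=.
  by rewrite sub0r normrN => /(le_lt_trans (ler_norm _)) ?; exists N.
set P := \sum_(k < N.+1) iter k T (Q + e%:M).
have es : (Q + e%:M)^T = Q + e%:M by rewrite linearD /= Qs tr_scalar_mx.
have itsym k V : V^T = V -> (iter k T V)^T = iter k T V.
  by move=> Vs; elim: k => //= k; exact: T_sym.
have ep : psdmx (Q + e%:M).
  by apply: psdmxD => //; apply/posdefmx_psd/posdefmx_scalar.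
exists P; split.
(* The summand e I of the first term alone makes P positive definite. *)
- rewrite /P big_ord_recl /= [Q + _]addrC -addrA.
  apply: posdefmx_pert; first exact: posdefmx_scalar.
    rewrite linearD /= Qs linear_sum /=; congr (_ + _).
    by apply: eq_bigr => k _; rewrite (itsym k.+1) // linearD /= Qs tr_scalar_mx.
  apply: psdmxD => //; apply: (@psdmx_sum n N (fun k => iter k.+1 T (e%:M + Q))) => k.
  by apply: (iter_psd k.+1); rewrite addrC.
(* Telescoping gives P - T P = (Q + e I) - T^(N+1) (Q + e I), and Q cancels. *)
- have -> : P - T P - Q = e%:M - iter N.+1 T (Q + e%:M).
    rewrite /P linear_sum -sumrB /=.
    under eq_bigr => k _ do rewrite -iterS iterSr -iter_linearB.
    by rewrite sum_iter_telescope addrAC [Q + _]addrC addrK.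
  split; first by rewrite linearB /= tr_scalar_mx (itsym N.+1).
  move=> x x0; rewrite qformB subr_gt0.
  have qI : psdmx (q *: 1%:M - (Q + e%:M)).
    by apply/psdmxBE => y; rewrite qformZ mulmx1.
  have /psdmxBE/(_ x) := iter_mono N.+1 qI; rewrite iter_linearZ qformZ => /le_lt_trans; apply.
  rewrite (le_lt_trans (ler_wpM2l q0 (stab N.+1 x))) //.
  rewrite mul_mx_scalar -scalemxAl [ltRHS]mxE mulrA ltr_pM2r ?dotcol_gt0 //.
  rewrite ak mulrA (le_lt_trans _ NP) // ler_wpM2l ?(mulr_ge0 q0 (sqr_ge0 a)) //.
  by rewrite exprS ger_pMl ?exprn_gt0 // ltW // exprn_gt0.
- rewrite /P linear_sum linear_sum /=.
  under eq_bigr => k _ do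
    rewrite -scalemx1 iter_linearD iter_linearZ linearD linearZ linearD linearZ /=.
  rewrite big_split /= -mulr_sumr addrA.
  have := sP N.+1; have := ler_wpM2l (ltW e0) (sumI N.+1); lra.
Qed.

End Lyapunov.

(** * Kronecker products with the identity and the LMIs *)

Section KroneckerForms.
Set Implicit Arguments.
Unset Strict Implicit.
Context {R : realType}.

Lemma posdefmx_congr n (X M : 'M[R]_n) : X \in unitmx ->
  posdefmx (X^T *m M *m X) <-> posdefmx M.
Proof.
suff congr (Z N : 'M[R]_n) : Z \in unitmx -> posdefmx N -> posdefmx (Z^T *m N *m Z).
  move=> Xu; split=> [h|]; last exact: congr.
  have := congr (invmx X) _ _ h; rewrite unitmx_inv => /(_ Xu).
  by rewrite !mulmxA -trmx_mul mulmxV // trmx1 mul1mx mulmxK.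
move=> Zu [Ns N0]; split; first by rewrite !trmx_mul trmxK Ns mulmxA.
move=> x x0; have := N0 (Z *m x); rewrite trmx_mul !mulmxA; apply.
by apply: contra x0 => /eqP e; rewrite -(mulKmx Zu x) e mulmx0.
Qed.

(** A nonzero x at which the form vanishes would satisfy (x^T x)^2 <= 0, by Cauchy-Schwarz against
    [N^T *m x]. *)
Lemma psdmx_unit_posdef n (M N : 'M[R]_n) : M^T = M -> psdmx M -> M *m N = 1%:M ->
  posdefmx M.
Proof.
move=> Ms M0 MN; split=> // x x0; rewrite lt_def M0 andbT; apply/eqP => e.
have := psdmx_cauchy x (N^T *m x) Ms M0.
rewrite e mulr0 trmx_mul trmxK -(mulmxA _ N M) (mulmx1C MN) mulmx1.
by rewrite leNgt exprn_gt0 // dotcol_gt0.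
Qed.

Lemma big_mxtens (V : nmodType) m q (F : 'I_(m * q) -> V) :
  \sum_r F r = \sum_i \sum_a F (mxtens_index (i, a)).
Proof.
rewrite pair_bigA /= (reindex (@mxtens_index m q)) /=; first by apply: eq_bigr => -[].
by exists (@mxtens_unindex m q) => x _; rewrite (mxtens_indexK, mxtens_unindexK).
Qed.

(** When H stacks the factor blocks of the second moments of a random matrix M, this is
    E[M^T V M]. *)
Definition kconj m q p (H : 'M[R]_(m * q, p)) (V : 'M[R]_m) : 'M[R]_p :=
  H^T *m (V *t (1%:M : 'M[R]_q)) *m H.

Lemma kconjE m q p (H : 'M[R]_(m * q, p)) V b e :
  kconj H V b e =
  \sum_i \sum_j V i j * \sum_a H (mxtens_index (i, a)) b * H (mxtens_index (j, a)) e.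
Proof.
rewrite /kconj -mulmxA mxE big_mxtens; apply: eq_bigr => i _.
transitivity (\sum_a \sum_j V i j * (H (mxtens_index (i, a)) b * H (mxtens_index (j, a)) e)).
  apply: eq_bigr => a _; rewrite !mxE big_mxtens mulr_sumr; apply: eq_bigr => j _.
  rewrite (bigD1 a) //= big1 ?addr0 => [|a' /negPf na].
    by rewrite tensmxE !mxE eqxx mulr1; ring.
  by rewrite tensmxE mxE eq_sym na mulr0 mul0r.
by rewrite exchange_big; apply: eq_bigr => j _; rewrite mulr_sumr.
Qed.

Lemma kconj_is_linear m q p (H : 'M[R]_(m * q, p)) : linear (kconj H).
Proof.
move=> c U V; apply/matrixP => b e.
rewrite kconjE [RHS]mxE [(c *: kconj H U) b e]mxE !kconjE mulr_sumr -big_split /=.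
apply: eq_bigr => i _; rewrite mulr_sumr -big_split; apply: eq_bigr => j _ /=.
by rewrite !mxE; ring.
Qed.

HB.instance Definition _ m q p (H : 'M[R]_(m * q, p)) :=
  GRing.isLinear.Build R 'M[R]_m 'M[R]_p _ (kconj H) (kconj_is_linear H).

(** The form V (x) I at y = H x is the sum over a of the form V at the slices (y_(i,a))_i. *)
Lemma kconj_psd m q p (H : 'M[R]_(m * q, p)) V : psdmx V -> psdmx (kconj H V).
Proof.
move=> V0 x.
have -> : x^T *m kconj H V *m x = kconj (H *m x) V by rewrite /kconj trmx_mul !mulmxA.
rewrite kconjE; set y := H *m x.
have -> : \sum_i \sum_j V i j *
      \sum_a y (mxtens_index (i, a)) 0 * y (mxtens_index (j, a)) 0 =
    \sum_a ((\col_i y (mxtens_index (i, a)) 0)^T *m V *m (\col_i y (mxtens_index (i, a)) 0)) 0 0.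
  under eq_bigr do under eq_bigr do rewrite mulr_sumr.
  under eq_bigr do rewrite exchange_big /=.
  rewrite exchange_big /=; apply: eq_bigr => a _.
  rewrite -mulmxA mxE; apply: eq_bigr => i _; rewrite !mxE mulr_sumr.
  by apply: eq_bigr => j _; rewrite !mxE; ring.
by apply: sumr_ge0 => a _; exact: V0.
Qed.

Lemma kconj_sym m q p (H : 'M[R]_(m * q, p)) V : V^T = V -> (kconj H V)^T = kconj H V.
Proof. by move=> Vs; rewrite /kconj !trmx_mul trmxK trmx_tens Vs trmx1 mulmxA. Qed.

Lemma tensmx11 m q : (1%:M : 'M[R]_m) *t (1%:M : 'M[R]_q) = 1%:M.
Proof.
apply/matrixP => r s; case: (mxtens_indexP r) => i a; case: (mxtens_indexP s) => j b.
by rewrite tensmxE !mxE (can_eq (@mxtens_indexK m q)) xpair_eqE -natrM mulnb.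
Qed.

Lemma tens1_mulV n q (X : 'M[R]_n) : X \in unitmx ->
  (X *t (1%:M : 'M[R]_q)) *m (invmx X *t 1%:M) = 1%:M.
Proof. by move=> Xu; rewrite tensmx_mul mulmxV // mulmx1 tensmx11. Qed.

(** X (x) I is a nonnegative form, being [kconj] of X along the identity, and it has the inverse
    X^-1 (x) I. *)
Lemma posdefmx_tens1 n q (X : 'M[R]_n) : posdefmx X -> posdefmx (X *t (1%:M : 'M[R]_q)).
Proof.
move=> Xp; have Xu := posdefmx_unit Xp; have [Xs _] := Xp.
apply: psdmx_unit_posdef (tens1_mulV q Xu); first by rewrite trmx_tens Xs trmx1.
by have := kconj_psd (1%:M : 'M[R]_(n * q)) (posdefmx_psd Xp); rewrite /kconj trmx1 mul1mx mulmx1.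
Qed.

(** Schur complements in the identity block and then in X (x) I leave X - (C X)^T (C X) - (A X)^T
    (X^-1 (x) I) (A X), which is the right-hand matrix conjugated by X. *)
Lemma lmi_stabP n pu qz nu qzu (GAB : 'M[R]_(nu, n * n + n * pu))
    (GCD : 'M[R]_(qzu, qz * n + qz * pu)) (X : 'M[R]_n) (F : 'M[R]_(pu, n)) :
  posdefmx X ->
  posdefmx (lmi_stab GAB GCD X (F *m X)) <->
  posdefmx (invmx X - kconj (tA GAB + tBu GAB *m F) (invmx X) -
            (tC GCD + tDu GCD *m F)^T *m (tC GCD + tDu GCD *m F)).
Proof.
move=> Xp; have Xu := posdefmx_unit Xp; have [Xs _] := Xp.
rewrite /lmi_stab !mulmxA -!mulmxDl; move: (tA _ + _) (tC _ + _) => A C.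
rewrite -(posdefmx_congr _ Xu) (posdefmx_schur _ _ (mulmx1 1%:M)).
set M := X^T *m _ *m X.
have -> : symblock X (A *m X) (X *t 1%:M) -
      (row_mx (C *m X) 0)^T *m 1%:M *m row_mx (C *m X) 0 =
    symblock (X - (C *m X)^T *m (C *m X)) (A *m X) (X *t (1%:M : 'M[R]_nu)).
  rewrite mulmx1 tr_row_mx mul_col_row trmx0 !mulmx0 mul0mx /symblock.
  by rewrite opp_block_mx add_block_mx !subr0.
rewrite (posdefmx_schur _ _ (tens1_mulV nu Xu)).
have -> : X - (C *m X)^T *m (C *m X) - (A *m X)^T *m (invmx X *t 1%:M) *m (A *m X) = M.
  rewrite /M !mulmxBr !mulmxBl Xs mulmxV // mul1mx addrAC /kconj !trmx_mul Xs.
  by rewrite !mulmxA.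
split=> [[_ []] //|Mp]; split; first exact: posdefmx_scalar.
by split=> //; exact: posdefmx_tens1.
Qed.

Lemma lmi_perfP n pw rw (GBw : 'M[R]_(rw, n * pw)) (X : 'M[R]_n) (S ED : 'M[R]_pw) :
  posdefmx X ->
  posdefmx (lmi_perf GBw X S ED) <-> posdefmx (S - ED - kconj (tBw GBw) (invmx X)).
Proof.
move=> Xp; rewrite /lmi_perf (posdefmx_schur _ _ (tens1_mulV rw (posdefmx_unit Xp))).
by split=> [[] //|h]; split=> //; exact: posdefmx_tens1.
Qed.

(** The coefficients that express entry (i, j) of A + B F linearly in [row(A), row(B)]. Applied to
    the factor G instead, they give column j of block i of the stacked matrix. *)
Definition entry_col m n p (F : 'M[R]_(p, n)) (i : 'I_m) (j : 'I_n) : 'cV[R]_(m * n + m * p) :=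
  col_mx (delta_mx (mxvec_index i j) 0) (\sum_l F l j *: delta_mx (mxvec_index i l) 0).

Lemma mul_entry_col m n p q (F : 'M[R]_(p, n)) (i : 'I_m) (j : 'I_n)
    (G : 'M[R]_(q, m * n + m * p)) a :
  (G *m entry_col F i j) a 0 =
  (restack (lsubmx G) + restack (rsubmx G) *m F) (mxtens_index (i, a)) j.
Proof.
rewrite -{1}(hsubmxK G) /entry_col mul_row_col mulmx_sumr [LHS]mxE [RHS]mxE.
congr (_ + _); first by rewrite -colE !mxE mxtens_indexK.
rewrite summxE mxE; apply: eq_bigr => l _; rewrite -scalemxAr -colE !mxE mxtens_indexK /=.
by rewrite mulrC.
Qed.

Lemma row_entry_col m n p (F : 'M[R]_(p, n)) (i : 'I_m) (j : 'I_n)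
    (A : 'M[R]_(m, n)) (B : 'M[R]_(m, p)) :
  (row_mx (mxvec A) (mxvec B) *m entry_col F i j) 0 0 = (A + B *m F) i j.
Proof.
rewrite mul_row_col mulmx_sumr [LHS]mxE [RHS]mxE; congr (_ + _).
  by rewrite -colE mxE mxvecE.
rewrite summxE mxE; apply: eq_bigr => l _.
by rewrite -scalemxAr -colE !mxE mxvecE mulrC.
Qed.

End KroneckerForms.

(** * Independence and second moments *)

Section WeightedTransfer.
Set Implicit Arguments.
Unset Strict Implicit.
Local Open Scope ereal_scope.
Import HBNNSimple.
Context {d d' : measure_display} {T : measurableType d} {T' : measurableType d'} {R : realType}.
Variables (mu : {measure set T -> \bar R}) (phi psi : T -> T').
Hypotheses (mphi : measurable_fun setT phi) (mpsi : measurable_fun setT psi).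
Variables (D : set T) (W : T -> \bar R) (c : R).
Hypotheses (mD : measurable D) (mW : measurable_fun setT W) (W0 : forall x, 0 <= W x).
Hypothesis Wfin : forall x, W x \is a fin_num.
(** Under the weight W on D, [phi] has c times the law of [psi]. *)
Hypothesis weightE : forall B, measurable B ->
  \int[mu]_(x in D `&` phi @^-1` B) W x = c%:E * mu (psi @^-1` B).

(** On simple functions both sides are finite sums over level sets, where the weight hypothesis
    applies term by term. *)
Let weight_nnsfun (f : {nnsfun T' >-> R}) :
  \int[mu]_(x in D) ((f (phi x))%:E * W x) = c%:E * \int[mu]_x (f (psi x))%:E.
Proof.
have mf k : measurable (f @^-1` [set k]) by exact: measurable_sfunP.
have mpre (chi : T -> T') k : measurable_fun setT chi -> measurable (chi @^-1` (f @^-1` [set k])).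
  by move=> mchi; rewrite -[_ @^-1` _]setTI; exact: mchi.
have fE y : (f y)%:E = \sum_(k \in range f) k%:E * (\1_(f @^-1` [set k]) y)%:E.
  by rewrite fimfunE -fsumEFin//; apply: eq_fsbigr => k _; rewrite EFinM.
have k0 y k : 0 <= k%:E * (\1_(f @^-1` [set k]) y)%:E.
  by rewrite nnfun_muleindic_ge0.
have mind (chi : T -> T') k : measurable_fun setT chi ->
    measurable_fun setT (fun x => k%:E * (\1_(f @^-1` [set k]) (chi x))%:E).
  move=> mchi; apply/measurable_EFinP => /=; apply: measurable_funM => //.
  by apply: (measurableT_comp _ mchi); exact: measurable_indic.
transitivity (\sum_(k \in range f) k%:E * (c%:E * mu (psi @^-1` (f @^-1` [set k])))).
  under eq_integral => x _ do rewrite fE ge0_mule_fsuml //.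
  rewrite ge0_integral_fsum //; last 2 first.
  - by move=> k; apply: emeasurable_funM; apply: measurable_funTS => //; exact: mind.
  - by move=> k x _; rewrite mule_ge0.
  apply: eq_fsbigr => k; rewrite inE => -[y _ fy].
  have kge0 : (0 <= k)%R by rewrite -fy.
  under eq_integral => x _ do rewrite -muleA.
  rewrite ge0_integralZl_EFin //; last 2 first.
  - by move=> x _; rewrite mule_ge0 // lee_fin.
  - apply: emeasurable_funM; apply: measurable_funTS => //.
    by apply/measurable_EFinP; apply: (measurableT_comp _ mphi); exact: measurable_indic.
  rewrite -weightE // integral_mkcondr; congr (_ * _); apply: eq_integral => x _.
  rewrite patchE indicE.
  have -> : (x \in phi @^-1` (f @^-1` [set k])) = (phi x \in f @^-1` [set k]).
    by apply/idP/idP; rewrite !inE.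
  by case: ifP => _; rewrite (mul1e, mul0e).
under [in RHS]eq_integral => x _ do rewrite fE.
rewrite ge0_integral_fsum //; last by move=> k; exact: mind.
rewrite ge0_mule_fsumr; last by move=> k; exact: integral_ge0.
apply: eq_fsbigr => k; rewrite inE => -[y _ fy].
have kge0 : (0 <= k)%R by rewrite -fy.
rewrite ge0_integralZl_EFin //; last first.
  by apply/measurable_EFinP; apply: (measurableT_comp _ mpsi); exact: measurable_indic.
have -> : \int[mu]_x (\1_(f @^-1` [set k]) (psi x))%:E = mu (psi @^-1` (f @^-1` [set k])).
  rewrite -[psi @^-1` _]setIT -integral_indic //; last exact: mpre.
by rewrite muleCA.
Qed.

(** Increasing simple functions approximate h, and monotone convergence passes to the limit on both
    sides. *)
Lemma ge0_weighted_transfer (h : T' -> \bar R) :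
  measurable_fun setT h -> (forall y, 0 <= h y) ->
  \int[mu]_(x in D) (h (phi x) * W x) = c%:E * \int[mu]_x h (psi x).
Proof.
move=> mh h0; pose f := nnsfun_approx measurableT mh.
have fcvg y : EFin (f n y) @[n --> \oo] --> h y by exact: cvg_nnsfun_approx.
have fnd y : {homo (fun n => f n y) : n m / (n <= m)%N >-> (n <= m)%R}.
  by move=> n m nm; exact/lefP/nd_nnsfun_approx.
have mf (chi : T -> T') n : measurable_fun setT chi ->
    measurable_fun setT (fun x => (f n (chi x))%:E).
  by move=> mchi; apply/measurable_EFinP; exact: (measurableT_comp _ mchi).
have L : \int[mu]_(x in D) ((f n (phi x))%:E * W x) @[n --> \oo] -->
    \int[mu]_(x in D) (h (phi x) * W x).
  rewrite [X in _ --> X](_ : _ = \int[mu]_(x in D) limn (fun n => (f n (phi x))%:E * W x)).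
    apply: cvg_monotone_convergence => //.
    - by move=> n; apply: emeasurable_funM; apply: measurable_funTS => //; exact: mf.
    - by move=> n x _; rewrite mule_ge0 // lee_fin.
    - by move=> x _ n m nm; rewrite lee_wpmul2r // lee_fin fnd.
  apply: eq_integral => x _; apply/esym/cvg_lim => //.
  by apply: cvgeZr.
have L' : \int[mu]_x (f n (psi x))%:E @[n --> \oo] --> \int[mu]_x h (psi x).
  rewrite [X in _ --> X](_ : _ = \int[mu]_x limn (fun n => (f n (psi x))%:E)).
    apply: cvg_monotone_convergence => //.
    - by move=> n; exact: mf.
    - by move=> n x _; rewrite lee_fin.
    - by move=> x _ n m nm; rewrite lee_fin fnd.
  by apply: eq_integral => x _; apply/esym/cvg_lim.
apply: (cvg_unique _ L) => //=.
under eq_fun do rewrite weight_nnsfun.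
by apply: cvgeZl.
Qed.
End WeightedTransfer.

(** * Product rule for weights depending on the past *)

Section IndependentWeights.
Set Implicit Arguments.
Unset Strict Implicit.
Local Open Scope ereal_scope.
Context {d : measure_display} {Omega : measurableType d} {R : realType}.
Variables (P : probability Omega R) (Z : nat) (xi : nat -> Omega -> 'cV[R]_Z).
Hypotheses (xi_rv : forall k, random_vector (xi k))
  (xi_indep : independent_seq P xi) (xi_id : identically_distributed P xi).

Local Notation event J B := (\bigcap_(j in [set` J]) (xi j @^-1` B j)).

(* [W] behaves like a nonnegative function of [xi 0, ..., xi (k - 1)]: weighting
   [P] by it preserves the product rule for [xi k, xi (k + 1), ...]. *)
Definition past_weight (k : nat) (W : Omega -> R) : Prop :=
  [/\ forall w, (0 <= W w)%R, P.-integrable setT (EFin \o W) &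
    forall (J : seq nat) (B : nat -> set (borel 'cV[R]_Z)),
      uniq J -> all (leq k) J -> (forall j, measurable (B j)) ->
      \int[P]_(w in event J B) (W w)%:E =
      \prod_(j <- J) P (xi j @^-1` B j) * \int[P]_w (W w)%:E].

Let mpre k (B : set (borel 'cV[R]_Z)) : measurable B -> measurable (xi k @^-1` B).
Proof. by move=> mB; rewrite -[_ @^-1` _]setTI; exact: xi_rv. Qed.

Let mevent (J : seq nat) (B : nat -> set (borel 'cV[R]_Z)) :
  (forall j, measurable (B j)) -> measurable (event J B).
Proof. by move=> mB; apply: fin_bigcap_measurable => // j _; exact: mpre. Qed.

Let prodP_fin J (B : nat -> set (borel 'cV[R]_Z)) : (forall j, measurable (B j)) ->
  \prod_(j <- J) P (xi j @^-1` B j) \is a fin_num.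
Proof.
move=> mB; elim/big_ind: _ => //; first exact: fin_numM.
by move=> j _; apply: fin_num_measure; exact: mpre.
Qed.

(** Base case of the product rule, and the point where independence enters. *)
Lemma past_weight_cst k (c : R) : (0 <= c)%R -> past_weight k (cst c).
Proof.
move=> c0; split=> //.
  exact: (finite_measure_integrable_cst P c).
move=> J B uJ kJ mB; have mE := mevent J mB.
have cE E : measurable E -> \int[P]_(w in E) (cst c w)%:E = c%:E * P E.
  by move=> mE1; rewrite -(integral_cst P mE1 c%:E).
by rewrite !cE // probability_setT mule1 xi_indep // muleC.
Qed.

Lemma past_weightD k V W : past_weight k V -> past_weight k W ->
  past_weight k (fun w => V w + W w)%R.
Proof.
move=> [V0 iV VE] [W0 iW WE]; split.
- by move=> w; rewrite addr_ge0.
- exact: (integrableD _ iV iW).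
have mV := measurable_int _ iV; have mW := measurable_int _ iW.
have D E : measurable E -> \int[P]_(w in E) (V w + W w)%:E =
    \int[P]_(w in E) (V w)%:E + \int[P]_(w in E) (W w)%:E.
  move=> mE; under eq_integral do rewrite EFinD.
  rewrite ge0_integralD //.
  - by move=> w _; rewrite lee_fin.
  - exact: measurable_funTS.
  - by move=> w _; rewrite lee_fin.
  - exact: measurable_funTS.
move=> J B uJ kJ mB; rewrite D; last exact: mevent.
rewrite VE // WE // D // [RHS]muleDr // ?prodP_fin //.
by rewrite fin_num_adde_defr // integrable_fin_num.
Qed.

(** On an event about later indices, W satisfies the product rule with index k added, so under this
    weight xi_k has the law of xi_0 up to a constant. The transfer lemma then trades h(xi_k) for
    h(xi_0). *)
Lemma past_weightM k W (h : borel 'cV[R]_Z -> R) :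
  past_weight k W -> measurable_fun setT h -> (forall x, 0 <= h x)%R ->
  P.-integrable setT (fun w => (h (xi 0%N w))%:E) ->
  past_weight k.+1 (fun w => h (xi k w) * W w)%R /\
  \int[P]_w (h (xi k w) * W w)%:E = \int[P]_w (h (xi 0%N w))%:E * \int[P]_w (W w)%:E.
Proof.
move=> [W0 iW WE] mh h0 ih.
have mW := measurable_int _ iW.
have IW : \int[P]_w (W w)%:E \is a fin_num by exact: integrable_fin_num.
have key (J : seq nat) (B : nat -> set (borel 'cV[R]_Z)) :
    uniq J -> all (leq k.+1) J -> (forall j, measurable (B j)) ->
    \int[P]_(w in event J B) (h (xi k w) * W w)%:E =
    \prod_(j <- J) P (xi j @^-1` B j) * \int[P]_w (W w)%:E * \int[P]_w (h (xi 0%N w))%:E.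
  move=> uJ kJ mB; set c := _ * \int[P]_w (W w)%:E.
  have cfin : c \is a fin_num by rewrite fin_numM // prodP_fin.
  rewrite -[c]fineK //; under eq_integral do rewrite EFinM.
  apply: (@ge0_weighted_transfer _ _ _ _ _ P _ _ (xi_rv k) (xi_rv 0%N)
    (event J B) (EFin \o W) (fine c) _ mW _ _ _ (EFin \o h)) => //.
  - exact: mevent.
  - move=> B0 mB0; rewrite fineK //.
    have kNJ : k \notin J by apply/negP => /(allP kJ); rewrite ltnn.
    (* All indices in J exceed k, so the condition that xi_k lies in B0 can be added as a new index
       with its own set. *)
    pose B' j := if j == k then B0 else B j.
    have B'J j : j \in J -> B' j = B j.
      by move=> jJ; rewrite /B'; case: eqP => // jk; rewrite -jk jJ in kNJ.
    have -> : event J B `&` xi k @^-1` B0 = event (k :: J) B'.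
      apply/seteqP; split=> w /=.
        move=> [wJ wk] j /=; rewrite inE /B' => /orP[/eqP->|jJ]; first by rewrite eqxx.
        by rewrite -/(B' j) B'J //; exact: wJ.
      move=> wJ; split; last by have := wJ k (mem_head _ _); rewrite /B' eqxx.
      by move=> j jJ; have := wJ j; rewrite /= inE jJ orbT B'J // => /(_ isT).
    rewrite WE /= ?kNJ ?uJ ?leqnn //.
    + rewrite big_cons {1}/B' eqxx (xi_id k 0%N) //.
      rewrite (eq_big_seq (fun j => P (xi j @^-1` B j))); last by move=> j jJ; rewrite B'J.
      by rewrite /c -muleA muleC.
    + by apply/allP => j /(allP kJ); exact: ltnW.
    + by move=> j; rewrite /B'; case: ifP.
  - exact/measurable_EFinP.
(* The empty J gives the product formula for the full integral. *)
have IE : \int[P]_w (h (xi k w) * W w)%:E = \int[P]_w (h (xi 0%N w))%:E * \int[P]_w (W w)%:E.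
  have := key [::] (fun=> setT) isT isT (fun=> measurableT).
  by rewrite big_nil mul1e set_nil bigcap_set0 muleC.
split=> //; split.
- by move=> w; rewrite mulr_ge0.
- apply/integrableP; split.
    apply/measurable_EFinP; apply: measurable_funM; last exact/measurable_EFinP.
    exact: (measurableT_comp mh (xi_rv k)).
  under eq_integral => w _ do rewrite /= ger0_norm ?mulr_ge0 //.
  by rewrite IE ltey_eq fin_numM // integrable_fin_num.
- by move=> J B uJ kJ mB; rewrite key // IE -muleA [X in _ * X]muleC.
Qed.

End IndependentWeights.

(** * Means of products and propagation of second moments *)

Section Moments.
Set Implicit Arguments.
Unset Strict Implicit.
Context {d : measure_display} {Omega : measurableType d} {R : realType}.
Variable P : probability Omega R.

(** Integrability is carried along with the value, so that sums and multiples need no separate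
    integrability argument. *)
Definition has_mean (f : Omega -> R) (r : R) : Prop :=
  P.-integrable setT (EFin \o f) /\ (\int[P]_w (f w)%:E = r%:E)%E.

Lemma integrable_has_mean f : P.-integrable setT (EFin \o f) ->
  has_mean f (fine (\int[P]_w (f w)%:E)%E).
Proof. by move=> fi; split=> //; rewrite fineK // integrable_fin_num. Qed.

Lemma has_mean_fine f r : has_mean f r -> fine (\int[P]_w (f w)%:E)%E = r.
Proof. by case=> _ ->. Qed.

Lemma has_mean_expectation f r : has_mean f r -> ('E_P[f] = r%:E)%E.
Proof. by case=> _ <-; rewrite unlock. Qed.

Lemma has_mean_eq f g r : f =1 g -> has_mean f r -> has_mean g r.
Proof. by move=> /funext ->. Qed.

Lemma has_mean_cst r : has_mean (cst r) r.
Proof.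
split; first exact: (finite_measure_integrable_cst P r).
by rewrite -[RHS]mule1 -(probability_setT P) -(integral_cst P measurableT r%:E).
Qed.

Lemma has_meanD f g r s : has_mean f r -> has_mean g s ->
  has_mean (fun w => f w + g w) (r + s).
Proof.
move=> [fi fE] [gi gE]; split; first exact: (integrableD _ fi gi).
by rewrite EFinD -fE -gE -(integralD_EFin _ fi gi).
Qed.

Lemma has_meanZ f r c : has_mean f r -> has_mean (fun w => c * f w) (c * r).
Proof.
move=> [fi fE]; split; first exact: (integrableZl _ c fi).
by rewrite EFinM -fE -(integralZl _ fi).
Qed.

Lemma has_mean_sum (I : finType) (f : I -> Omega -> R) r :
  (forall i, has_mean (f i) (r i)) -> has_mean (fun w => \sum_i f i w) (\sum_i r i).
Proof.
move=> fr; elim: (index_enum I) => [|i s IH].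
  by rewrite big_nil; apply: has_mean_eq (has_mean_cst 0) => w; rewrite big_nil.
rewrite big_cons; apply: has_mean_eq (has_meanD (fr i) IH) => w.
by rewrite big_cons.
Qed.

Variables (Z : nat) (xi : nat -> Omega -> 'cV[R]_Z).
Hypotheses (xi_rv : forall k, random_vector (xi k))
  (xi_indep : independent_seq P xi) (xi_id : identically_distributed P xi).

(** Signed version of [past_weight], since products of matrix entries may change sign. *)
Definition past (k : nat) (W : Omega -> R) : Prop :=
  exists W1 W2, [/\ past_weight P xi k W1, past_weight P xi k W2 &
    forall w, W w = W1 w - W2 w].

Lemma past_eq k V W : V =1 W -> past k V -> past k W.
Proof. by move=> /funext ->. Qed.

Lemma past_cst k c : past k (cst c).
Proof.
have [c0|c0] := leP 0 c.
  exists (cst c), (cst 0); split; try exact: past_weight_cst.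
  by move=> w; rewrite subr0.
exists (cst 0), (cst (- c)); split; try (apply: past_weight_cst => //; lra).
by move=> w; rewrite /cst /=; lra.
Qed.

Lemma pastD k V W : past k V -> past k W -> past k (fun w => V w + W w).
Proof.
move=> [V1 [V2 [pV1 pV2 VE]]] [W1 [W2 [pW1 pW2 WE]]].
exists (fun w => V1 w + W1 w), (fun w => V2 w + W2 w).
split; try exact: past_weightD.
by move=> w; rewrite VE WE; ring.
Qed.

Lemma past_sum k (I : finType) (W : I -> Omega -> R) :
  (forall i, past k (W i)) -> past k (fun w => \sum_i W i w).
Proof.
move=> pW; elim: (index_enum I) => [|i s IH].
  by apply: past_eq (past_cst k 0) => w; rewrite big_nil.
by apply: past_eq (pastD (pW i) IH) => w; rewrite big_cons.
Qed.

Lemma past_has_mean k W : past k W -> has_mean W (fine (\int[P]_w (W w)%:E)%E).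
Proof.
move=> [W1 [W2 [[_ i1 _] [_ i2 _] WE]]]; apply: integrable_has_mean.
by rewrite (_ : EFin \o W = (EFin \o W1) \- (EFin \o W2))%E;
  [exact: integrableB|apply/funext => w /=; rewrite WE].
Qed.

Lemma pastM k W (h : borel 'cV[R]_Z -> R) r s :
  past k W -> has_mean W r -> measurable_fun setT h ->
  has_mean (fun w => h (xi 0%N w)) s ->
  past k.+1 (fun w => h (xi k w) * W w) /\ has_mean (fun w => h (xi k w) * W w) (s * r).
Proof.
move=> [W1 [W2 [p1 p2 WE]]] Wr mh hs.
(* The splittings h = h^+ - h^- and W = W1 - W2 reduce everything to four products of nonnegative
   functions. *)
pose hp x := h^\+ x; pose hn x := h^\- x.
have hE x : h x = hp x - hn x by rewrite -[in LHS](funrposBneg h).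
have hp0 x : 0 <= hp x by exact: funrpos_ge0.
have hn0 x : 0 <= hn x by exact: funrneg_ge0.
have mp : measurable_fun setT hp by exact: measurable_funrpos.
have mn : measurable_fun setT hn by exact: measurable_funrneg.
have ip : P.-integrable setT (fun w => (hp (xi 0%N w))%:E).
  exact: (integrable_funrpos measurableT hs.1).
have im : P.-integrable setT (fun w => (hn (xi 0%N w))%:E).
  exact: (integrable_funrneg measurableT hs.1).
have step V (g : borel 'cV[R]_Z -> R) :
    past_weight P xi k V -> (forall x, 0 <= g x) -> measurable_fun setT g ->
    P.-integrable setT (fun w => (g (xi 0%N w))%:E) ->
    past_weight P xi k.+1 (fun w => g (xi k w) * V w) /\
    has_mean (fun w => g (xi k w) * V w)
      (fine (\int[P]_w (g (xi 0%N w))%:E)%E * fine (\int[P]_w (V w)%:E)%E).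
  move=> pV g0 mg ig; have [p e] := past_weightM xi_rv xi_id pV mg g0 ig.
  split=> //; split; first by case: p.
  by rewrite e EFinM !fineK // integrable_fin_num //; case: pV.
have [pp1 e1] := step _ _ p1 hp0 mp ip; have [pp2 e2] := step _ _ p2 hp0 mp ip.
have [pn1 f1] := step _ _ p1 hn0 mn im; have [pn2 f2] := step _ _ p2 hn0 mn im.
split.
  exists (fun w => hp (xi k w) * W1 w + hn (xi k w) * W2 w),
         (fun w => hp (xi k w) * W2 w + hn (xi k w) * W1 w).
  split; try exact: past_weightD.
  by move=> w; rewrite hE WE; ring.
have sE : s = fine (\int[P]_w (hp (xi 0%N w))%:E)%E - fine (\int[P]_w (hn (xi 0%N w))%:E)%E.
  rewrite -(has_mean_fine hs); apply: has_mean_fine.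
  rewrite -mulN1r; apply: has_mean_eq (has_meanD (integrable_has_mean ip)
     (has_meanZ (-1) (integrable_has_mean im))) => w.
  by rewrite /= hE mulN1r.
have rE : r = fine (\int[P]_w (W1 w)%:E)%E - fine (\int[P]_w (W2 w)%:E)%E.
  rewrite -(has_mean_fine Wr); apply: has_mean_fine.
  case: p1 p2 => _ i1 _ [_ i2 _].
  rewrite -mulN1r; apply: has_mean_eq (has_meanD (integrable_has_mean i1)
     (has_meanZ (-1) (integrable_has_mean i2))) => w.
  by rewrite /= WE mulN1r.
have := has_meanD (has_meanD e1 f2) (has_meanZ (-1) (has_meanD e2 f1)).
rewrite sE rE; set a := fine _; set b := fine _; set c := fine _; set e := fine _.
have -> : a * b + c * e + -1 * (a * e + c * b) = (a - c) * (b - e) by ring.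
by apply: has_mean_eq => w; rewrite hE WE; ring.
Qed.

(** [Ht] acts as a finite sample of H: its slices indexed by s, with rows (i, s), reproduce the
    second moments of the entries. Hence E[H^T V H] is [kconj Ht V]. *)
Definition moment_rep m n q (H : 'cV[R]_Z -> 'M[R]_(m, n)) (Ht : 'M[R]_(m * q, n)) : Prop :=
  (forall i a, measurable_fun setT (fun x : borel 'cV[R]_Z => H x i a)) /\
  forall i a j b, has_mean (fun w => H (xi 0%N w) i a * H (xi 0%N w) j b)
    (\sum_s Ht (mxtens_index (i, s)) a * Ht (mxtens_index (j, s)) b).

(** Pairs within one column suffice, because tr(M^T V M) involves no others. *)
Definition past_mx k n p (M : Omega -> 'M[R]_(n, p)) : Prop :=
  forall i j c, past k (fun w => M w i c * M w j c).

(** E[tr(M^T V M)], expanded over the second moments of the entries. *)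
Definition quad_mean n p (M : Omega -> 'M[R]_(n, p)) (V : 'M[R]_n) : R :=
  \sum_i \sum_j V i j * \sum_c fine (\int[P]_w (M w i c * M w j c)%:E)%E.

Lemma trace_quadE n p (M : 'M[R]_(n, p)) (V : 'M[R]_n) :
  \tr (M^T *m V *m M) = \sum_i \sum_j V i j * \sum_c M i c * M j c.
Proof.
rewrite /mxtrace.
transitivity (\sum_c \sum_i \sum_j V i j * (M i c * M j c)).
  apply: eq_bigr => c _; rewrite -mulmxA mxE; apply: eq_bigr => i _.
  by rewrite !mxE mulr_sumr; apply: eq_bigr => j _; ring.
rewrite exchange_big; apply: eq_bigr => i _.
by rewrite exchange_big; apply: eq_bigr => j _; rewrite mulr_sumr.
Qed.

Lemma quad_mean_trace k n p (M : Omega -> 'M[R]_(n, p)) V : past_mx k M ->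
  ('E_P[fun w => \tr ((M w)^T *m V *m M w)] = (quad_mean M V)%:E)%E.
Proof.
move=> pM; apply: has_mean_expectation; apply: has_mean_eq.
  by move=> w; rewrite trace_quadE.
apply: has_mean_sum => i; apply: has_mean_sum => j; apply: has_meanZ.
by apply: has_mean_sum => c; exact: past_has_mean (pM i j c).
Qed.

Lemma past_mx_cst k n p (M : 'M[R]_(n, p)) : past_mx k (fun=> M).
Proof. by move=> i j c; exact: past_cst. Qed.

Lemma quad_mean_cst n p (M : 'M[R]_(n, p)) V :
  quad_mean (fun=> M) V = \tr (M^T *m V *m M).
Proof.
rewrite trace_quadE; apply: eq_bigr => i _; apply: eq_bigr => j _; congr (_ * _).
by apply: eq_bigr => c _; exact: has_mean_fine (has_mean_cst _).
Qed.

Section Step.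
Variables (k m n p q : nat) (H : 'cV[R]_Z -> 'M[R]_(m, n)) (Ht : 'M[R]_(m * q, n)).
Variable M : Omega -> 'M[R]_(n, p).
Hypotheses (HHt : moment_rep H Ht) (pM : past_mx k M).

(** Expanding the product separates H_ia H_jb, a function of xi_k, from M_ac M_bc, which lies in the
    past. *)
Let stepE i j c : past k.+1 (fun w => (H (xi k w) *m M w) i c * (H (xi k w) *m M w) j c) /\
  has_mean (fun w => (H (xi k w) *m M w) i c * (H (xi k w) *m M w) j c)
    (\sum_a \sum_b (\sum_s Ht (mxtens_index (i, s)) a * Ht (mxtens_index (j, s)) b) *
      fine (\int[P]_w (M w a c * M w b c)%:E)%E).
Proof.
have E w : \sum_a \sum_b (H (xi k w) i a * H (xi k w) j b) * (M w a c * M w b c) =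
    (H (xi k w) *m M w) i c * (H (xi k w) *m M w) j c.
  rewrite !mxE mulr_suml; apply: eq_bigr => a _; rewrite mulr_sumr.
  by apply: eq_bigr => b _; ring.
have [mH HE] := HHt.
have S a b := pastM (h := fun x => H x i a * H x j b) (pM a b c)
  (past_has_mean (pM a b c)) (measurable_funM (mH i a) (mH j b)) (HE i a j b).
split.
  by apply: (past_eq E); apply: past_sum => a; apply: past_sum => b; case: (S a b).
by apply: (has_mean_eq E); apply: has_mean_sum => a; apply: has_mean_sum => b; case: (S a b).
Qed.

Lemma past_mx_step : past_mx k.+1 (fun w => H (xi k w) *m M w).
Proof. by move=> i j c; case: (stepE i j c). Qed.

(** Averaging over xi_k replaces V by E[H^T V H]. Iterating this moves all the randomness into a
    deterministic recursion on V. *)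
Lemma quad_mean_step V :
  quad_mean (fun w => H (xi k w) *m M w) V = quad_mean M (kconj Ht V).
Proof.
rewrite /quad_mean.
under eq_bigr => i _ do under eq_bigr => j _ do under eq_bigr => c _ do
  rewrite (has_mean_fine (stepE i j c).2).
set e := fun a b c => fine (\int[P]_w (M w a c * M w b c)%:E)%E.
set u := fun i j a b => \sum_s Ht (mxtens_index (i, s)) a * Ht (mxtens_index (j, s)) b.
transitivity (\sum_i \sum_j \sum_a \sum_b V i j * u i j a b * \sum_c e a b c).
  apply: eq_bigr => i _; apply: eq_bigr => j _.
  rewrite exchange_big mulr_sumr; apply: eq_bigr => a _.
  rewrite exchange_big mulr_sumr; apply: eq_bigr => b _.
  by rewrite -mulr_sumr mulrA.
under eq_bigr => i _ do rewrite exchange_big /=.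
rewrite exchange_big /=; apply: eq_bigr => a _.
under eq_bigr => i _ do rewrite exchange_big /=.
rewrite exchange_big /=; apply: eq_bigr => b _.
rewrite kconjE mulr_suml; apply: eq_bigr => i _.
by rewrite mulr_suml; apply: eq_bigr => j _.
Qed.
End Step.

End Moments.

(** * Plant and closed loop *)

Section PlantMoments.
Set Implicit Arguments.
Unset Strict Implicit.
Context {d : measure_display} {Omega : measurableType d} {R : realType}.
Variables (P : probability Omega R) (Z : nat) (xi : nat -> Omega -> 'cV[R]_Z).
Hypothesis xi_rv : forall k, random_vector (xi k).

Lemma measurable_coord m p i j :
  measurable_fun setT (fun x : borel 'M[R]_(m, p) => x i j).
Proof.
apply: (measurability _ (RGenOpens.measurableE R)).
move=> _ [_ [x [y ->]] <-]; rewrite setTI; apply: sub_sigma_algebra.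
apply: open_comp; last exact: interval_open.
by move=> M _; exact: coord_continuous.
Qed.

(** The complement is a union of null open sets. Closedness makes the support Borel, which the
    measurability of the extension by 0 relies on. *)
Lemma law_support_closed (X : Omega -> 'cV[R]_Z) : closed (law_support P X).
Proof.
rewrite -[law_support P X]setCK; apply: open_closedC; rewrite openE => x /= xX.
have [U [Uo Ux U0]] : exists U, [/\ open U, U x & ~ (0 < P (X @^-1` U))%E].
  apply: contrapT => nU; apply: xX => U Uo Ux; apply: contrapT => U0.
  by apply: nU; exists U.
by apply: filterS (open_nbhs_nbhs (conj Uo Ux)) => y Uy /(_ U Uo Uy).
Qed.

Lemma ext0_measurable (Xi : set 'cV[R]_Z) m p (f : Xi -> 'M[R]_(m, p)) i j :
  closed Xi -> borel_on f ->
  measurable_fun setT (fun x : borel 'cV[R]_Z => ext0 f x i j).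
Proof.
move=> cXi mf.
have mXi : measurable (Xi : set (borel 'cV[R]_Z)).
  by rewrite -[Xi]setCK; apply: measurableC; apply: sub_sigma_algebra; exact: closed_openC.
rewrite -(setUv (Xi : set (borel 'cV[R]_Z))); apply/measurable_funU => //.
  exact: measurableC.
split; first exact: (measurableT_comp (measurable_coord i j) mf).
have : measurable_fun (~` Xi : set (borel 'cV[R]_Z)) (cst 0 : borel 'cV[R]_Z -> R) by [].
apply: eq_measurable_fun => x; rewrite inE /= => nx.
by rewrite /ext0 insubN /= ?mxE //; apply/negP; rewrite inE.
Qed.

(** Domination by |f g| <= f^2 + g^2. *)
Lemma integrable_mul_sq (f g : Omega -> R) :
  measurable_fun setT f -> measurable_fun setT g ->
  P.-integrable setT (fun w => (f w ^+ 2)%:E) ->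
  P.-integrable setT (fun w => (g w ^+ 2)%:E) ->
  P.-integrable setT (fun w => (f w * g w)%:E).
Proof.
move=> mf mg f2 g2.
apply: (le_integrable measurableT _ _ (integrableD measurableT f2 g2)).
  by apply/measurable_EFinP; exact: measurable_funM.
move=> w _ /=; rewrite lee_fin normrM [leRHS]ger0_norm ?addr_ge0 ?sqr_ge0 //.
rewrite -(real_normK (num_real (f w))) -(real_normK (num_real (g w))).
have := normr_ge0 (f w); have := normr_ge0 (g w).
move: `|f w| `|g w| => a b; nra.
Qed.

Lemma second_moment_mean N (r : Omega -> 'rV[R]_N) u v :
  P.-integrable setT (fun w => (r w 0 u * r w 0 v)%:E) ->
  has_mean P (fun w => r w 0 u * r w 0 v) (second_moment P r u v).
Proof.
move=> ruv; rewrite /second_moment /Emx mxE unlock.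
under eq_integral => w _ do rewrite mxE big_ord1 mxE.
exact: integrable_has_mean.
Qed.

Definition sq_coef m p (H : 'cV[R]_Z -> 'M[R]_(m, p)) : Prop :=
  (forall i j, measurable_fun setT (fun x : borel 'cV[R]_Z => H x i j)) /\
  square_integrable P (H \o xi 0%N).

Lemma sq_coef_integrable m p m' p' (H : 'cV[R]_Z -> 'M[R]_(m, p))
    (K : 'cV[R]_Z -> 'M[R]_(m', p')) i j k l : sq_coef H -> sq_coef K ->
  P.-integrable setT (fun w => (H (xi 0%N w) i j * K (xi 0%N w) k l)%:E).
Proof.
move=> [mH H2] [mK K2]; apply: integrable_mul_sq; [| |exact: H2|exact: K2].
  exact: (measurableT_comp (mH i j) (xi_rv 0%N)).
exact: (measurableT_comp (mK k l) (xi_rv 0%N)).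
Qed.

(** Entries of A + B F and of the stacked matrix are the same linear combinations, of the
    coordinates of r and of the columns of G respectively. Both second moments are therefore c^T
    (G^T G) c'. *)
Lemma feedback_moment_rep m n p q (A : 'cV[R]_Z -> 'M[R]_(m, n))
    (B : 'cV[R]_Z -> 'M[R]_(m, p)) (F : 'M[R]_(p, n)) (G : 'M[R]_(q, m * n + m * p)) :
  sq_coef A -> sq_coef B ->
  G^T *m G = second_moment P
    (fun w => row_mx (mxvec (A (xi 0%N w))) (mxvec (B (xi 0%N w)))) ->
  moment_rep P xi (fun x => A x + B x *m F)
    (restack (lsubmx G) + restack (rsubmx G) *m F).
Proof.
move=> cA cB GE; split.
  move=> i a; under eq_fun do rewrite !mxE.
  apply: measurable_funD; first exact: cA.1.
  apply: measurable_sum => l; apply: measurable_funM => //.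
  exact: cB.1.
move=> i a j b.
set r := fun w => row_mx (mxvec (A (xi 0%N w))) (mxvec (B (xi 0%N w))).
have r2 u : measurable_fun setT (fun w => r w 0 u) /\
    P.-integrable setT (fun w => (r w 0 u ^+ 2)%:E).
  have coef2 m' p' (H : 'cV[R]_Z -> 'M[R]_(m', p')) k l : sq_coef H ->
      measurable_fun setT (fun w => H (xi 0%N w) k l) /\
      P.-integrable setT (fun w => (H (xi 0%N w) k l ^+ 2)%:E).
    by move=> [mH H2]; split; [exact: (measurableT_comp (mH k l) (xi_rv 0%N))|exact: H2].
  (* Every coordinate of r is an entry of A or of B. *)
  rewrite -(fintype.splitK u); case: (fintype.split u) => k; case/mxvec_indexP: k => k l /=.
    rewrite (_ : (fun w => r w 0 _) = (fun w => A (xi 0%N w) k l)); last first.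
      by apply/funext => w; rewrite row_mxEl mxvecE.
    rewrite (_ : (fun w => (r w 0 _ ^+ 2)%:E) = (fun w => (A (xi 0%N w) k l ^+ 2)%:E)); last first.
      by apply/funext => w; rewrite row_mxEl mxvecE.
    exact: coef2.
  rewrite (_ : (fun w => r w 0 _) = (fun w => B (xi 0%N w) k l)); last first.
    by apply/funext => w; rewrite row_mxEr mxvecE.
  rewrite (_ : (fun w => (r w 0 _ ^+ 2)%:E) = (fun w => (B (xi 0%N w) k l ^+ 2)%:E)); last first.
    by apply/funext => w; rewrite row_mxEr mxvecE.
  exact: coef2.
have rE u v : has_mean P (fun w => r w 0 u * r w 0 v) ((G^T *m G) u v).
  rewrite GE; apply: second_moment_mean.
  by apply: integrable_mul_sq; first [exact: (r2 _).1|exact: (r2 _).2].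
pose c k := entry_col F i a k 0; pose c' k := entry_col F j b k 0.
have -> : \sum_s (restack (lsubmx G) + restack (rsubmx G) *m F) (mxtens_index (i, s)) a *
      (restack (lsubmx G) + restack (rsubmx G) *m F) (mxtens_index (j, s)) b =
    \sum_u \sum_v (c u * c' v) * (G^T *m G) u v.
  have gE s k l : (restack (lsubmx G) + restack (rsubmx G) *m F) (mxtens_index (k, s)) l =
      \sum_u G s u * entry_col F k l u 0.
    by rewrite -mul_entry_col mxE.
  under eq_bigr => s _ do rewrite !gE mulr_suml.
  rewrite exchange_big /=; apply: eq_bigr => u _.
  under eq_bigr => s _ do rewrite mulr_sumr.
  rewrite exchange_big /=; apply: eq_bigr => v _.
  rewrite [(G^T *m G) u v]mxE mulr_sumr; apply: eq_bigr => s _; rewrite [G^T u s]mxE /c /c'; ring.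
apply: (has_mean_eq (f := fun w => \sum_u \sum_v (c u * c' v) * (r w 0 u * r w 0 v))).
  have eE w k l : (A (xi 0%N w) + B (xi 0%N w) *m F) k l = \sum_u r w 0 u * entry_col F k l u 0.
    by rewrite -row_entry_col mxE.
  move=> w; rewrite !eE mulr_suml; apply: eq_bigr => u _; rewrite mulr_sumr; apply: eq_bigr => v _.
  rewrite /c /c'; ring.
by apply: has_mean_sum => u; apply: has_mean_sum => v; exact: has_meanZ.
Qed.

Lemma mxvec_moment_rep m n q (B : 'cV[R]_Z -> 'M[R]_(m, n)) (G : 'M[R]_(q, m * n)) :
  sq_coef B ->
  G^T *m G = second_moment P (fun w => mxvec (B (xi 0%N w))) ->
  moment_rep P xi B (restack G).
Proof.
move=> cB GE; split; first exact: cB.1.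
move=> i a j b.
have -> : \sum_s restack G (mxtens_index (i, s)) a * restack G (mxtens_index (j, s)) b =
    (G^T *m G) (mxvec_index i a) (mxvec_index j b).
  by rewrite mxE; apply: eq_bigr => s _; rewrite !mxE !mxtens_indexK.
rewrite GE; have := @second_moment_mean _ (fun w => mxvec (B (xi 0%N w)))
  (mxvec_index i a) (mxvec_index j b).
under eq_fun do rewrite !mxvecE.
move=> h; have {h} := h (sq_coef_integrable i a j b cB cB).
by apply: has_mean_eq => w; rewrite !mxvecE.
Qed.

End PlantMoments.

(** * Closed-loop moments as iterates of a linear map *)

Section SystemMoments.
Set Implicit Arguments.
Unset Strict Implicit.
Context {d : measure_display} {Omega : measurableType d} {R : realType}.
Variables (P : probability Omega R) (Z : nat) (xi : nat -> Omega -> 'cV[R]_Z).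
Hypotheses (xi_rv : forall k, random_vector (xi k))
  (xi_indep : independent_seq P xi) (xi_id : identically_distributed P xi).
Variables (n pw qz nu qzu rw : nat) (S : @system R Z n pw qz).
Variables (At : 'M[R]_(n * nu, n)) (Bt : 'M[R]_(n * rw, pw)) (Ct : 'M[R]_(qz * qzu, n)).
Hypotheses (repA : moment_rep P xi (sysA S) At) (repB : moment_rep P xi (sysB S) Bt)
  (repC : moment_rep P xi (sysC S) Ct) (sqD : sq_coef P xi (sysD S)).

Local Notation T := (kconj At).

Lemma state_mean k (x0 : 'cV[R]_n) :
  ('E_P[fun w => (enorm (state xi S x0 (fun _ _ => 0) k w) ^+ 2)%R] =
   ((x0^T *m iter k T 1%:M *m x0) 0 0)%:E)%E.
Proof.
have pk m : past_mx P xi m (state xi S x0 (fun _ _ => 0) m).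
  elim: m => [|m IH] /=; first exact: past_mx_cst.
  under eq_fun do rewrite mulmx0 addr0.
  exact: past_mx_step repA IH.
(* V is kept general because each step replaces it by T V. *)
have qk m V : quad_mean P (state xi S x0 (fun _ _ => 0) m) V =
    (x0^T *m iter m T V *m x0) 0 0.
  elim: m V => [|m IH] V /=.
    by rewrite quad_mean_cst /mxtrace big_ord1.
  under eq_fun do rewrite mulmx0 addr0.
  by rewrite (quad_mean_step xi_rv xi_indep xi_id repA (pk m)) IH -iterSr.
rewrite -qk -(quad_mean_trace _ (pk k)).
congr ('E_P[_])%E; apply/funext => w.
rewrite /enorm sqr_sqrtr; last by apply: sumr_ge0 => i _; exact: sqr_ge0.
by rewrite mulmx1 /mxtrace big_ord1 dotcolE.
Qed.

Lemma kconj1 m q p (H : 'M[R]_(m * q, p)) : kconj H 1%:M = H^T *m H.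
Proof. by rewrite /kconj tensmx11 mulmx1. Qed.

Lemma h2_term_mean m :
  ('E_P[fun w => \tr ((sysB S (xi 0%N w))^T *m (Phi xi S 1 m.+1 w)^T *m
                        (sysC S (xi m.+1 w))^T *m sysC S (xi m.+1 w) *m
                        Phi xi S 1 m.+1 w *m sysB S (xi 0%N w))] =
   (\tr (kconj Bt (iter m T (Ct^T *m Ct))))%:E)%E.
Proof.
(* [N l] is Phi_1^(l+1) B(xi_0), which depends on xi_0, ..., xi_l; hence the index l + 1 in [pN]. *)
pose N l w := transition xi S 1 l w *m sysB S (xi 0%N w).
have NS l w : N l.+1 w = sysA S (xi l.+1 w) *m N l w by rewrite /N /= mulmxA add1n.
(* B(xi_0) itself becomes a step, applied to the constant identity matrix. *)
have N0 : N 0%N = (fun w => sysB S (xi 0%N w) *m 1%:M).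
  by apply/funext => w; rewrite /N /= mul1mx mulmx1.
have p1 := past_mx_cst xi_rv xi_indep 0%N (1%:M : 'M[R]_pw).
have pN l : past_mx P xi l.+1 (N l).
  elim: l => [|l IH]; first by rewrite N0; exact: past_mx_step repB p1.
  rewrite (_ : N l.+1 = (fun w => sysA S (xi l.+1 w) *m N l w)); last exact/funext.
  exact: past_mx_step repA IH.
have qN l V : quad_mean P (N l) V = \tr (kconj Bt (iter l T V)).
  elim: l V => [|l IH] V.
    rewrite N0 (quad_mean_step xi_rv xi_indep xi_id repB p1) quad_mean_cst.
    by rewrite trmx1 mul1mx mulmx1.
  rewrite (_ : N l.+1 = (fun w => sysA S (xi l.+1 w) *m N l w)); last exact/funext.
  by rewrite (quad_mean_step xi_rv xi_indep xi_id repA (pN l)) IH -iterSr.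
(* Since C~^T C~ is [kconj Ct 1%:M], the output map counts as one more step, taken with V = I. *)
rewrite -kconj1 -qN -(quad_mean_step xi_rv xi_indep xi_id repC (pN m)).
rewrite -(quad_mean_trace _ (past_mx_step xi_rv xi_indep xi_id repC (pN m))).
congr ('E_P[_])%E; apply/funext => w.
by rewrite mulmx1 /N /Phi subn1 !trmx_mul !mulmxA.
Qed.

Lemma D_term_mean :
  ('E_P[fun w => \tr ((sysD S (xi 0%N w))^T *m sysD S (xi 0%N w))] =
   (\tr (Emx P (fun w => (sysD S (xi 0%N w))^T *m sysD S (xi 0%N w))))%:E)%E.
Proof.
apply: has_mean_expectation; apply: has_mean_sum => i; rewrite mxE unlock.
apply: integrable_has_mean.
rewrite (_ : EFin \o _ = (fun w => \sum_l (sysD S (xi 0%N w) l i * sysD S (xi 0%N w) l i)%:E))%E.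
  by apply: integrable_sum => // l _; exact: sq_coef_integrable.
apply/funext => w /=; rewrite mxE -sumEFin; apply: eq_bigr => l _.
by rewrite mxE.
Qed.

Lemma h2sumE K : h2sum P xi S K =
  (\tr (Emx P (fun w => (sysD S (xi 0%N w))^T *m sysD S (xi 0%N w))) +
   \sum_(k < K) \tr (kconj Bt (iter k T (Ct^T *m Ct))))%:E.
Proof.
rewrite /h2sum D_term_mean EFinD; congr (_ + _)%E.
rewrite big_add1 /= big_mkord -sumEFin; apply: eq_bigr => k _.
exact: h2_term_mean.
Qed.

End SystemMoments.

(** * Equivalence with the matrix inequalities *)

Section Synthesis.
Set Implicit Arguments.
Unset Strict Implicit.

(** For a nondecreasing sequence the limit is the supremum, so it lies below gamma^2 exactly when
    one s < gamma^2 bounds all terms; the intermediate s preserves strictness in the limit. *)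
Lemma sqrte_limn_lt (R : realType) (u : nat -> R) (gamma : R) : 0 < gamma ->
  {homo u : m n / (m <= n)%N >-> m <= n} ->
  (sqrte (limn (fun K => (u K)%:E)) < gamma%:E)%E <->
  exists2 s, s < gamma ^+ 2 & forall K, u K <= s.
Proof.
move=> g0 u_nd.
have und : {homo (fun K => (u K)%:E) : m n / (m <= n)%N >-> (m <= n)%E}.
  by move=> m n mn; rewrite lee_fin u_nd.
have uL K : ((u K)%:E <= limn (fun K => (u K)%:E))%E.
  rewrite (cvg_lim _ (ereal_nondecreasing_cvgn und)) //.
  by apply: ereal_sup_ubound; exists K.
split.
  move: (limn _) uL => [r||] uL //=.
    rewrite lte_fin => rg; exists r; last by move=> K; have := uL K; rewrite lee_fin.
    by rewrite -(ltr_sqrt _ (exprn_gt0 2 g0)) sqrtr_sqr gtr0_norm.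
  by have := uL 0%N.
move=> [s sg us].
have : (limn (fun K => (u K)%:E) <= s%:E)%E.
  apply: lime_le; first exact: ereal_nondecreasing_is_cvgn.
  by apply: nearW => K; rewrite lee_fin.
move: (limn _) => [r||_] //=.
rewrite lee_fin lte_fin => rs.
by rewrite -[gamma]gtr0_norm // -sqrtr_sqr ltr_sqrt ?exprn_gt0 // (le_lt_trans rs).
Qed.

Context {d : measure_display} {Omega : measurableType d} {R : realType}.
Variables (P : probability Omega R) (Z : nat) (xi : nat -> Omega -> 'cV[R]_Z).
Hypotheses (xi_rv : forall k, random_vector (xi k))
  (xi_indep : independent_seq P xi) (xi_id : identically_distributed P xi).
Variables (n pw qz nu qzu rw : nat) (S : @system R Z n pw qz).
Variables (At : 'M[R]_(n * nu, n)) (Bt : 'M[R]_(n * rw, pw)) (Ct : 'M[R]_(qz * qzu, n)).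
Hypotheses (repA : moment_rep P xi (sysA S) At) (repB : moment_rep P xi (sysB S) Bt)
  (repC : moment_rep P xi (sysC S) Ct) (sqD : sq_coef P xi (sysD S)).

(** The second moment of the state is a quadratic form in x_0, so squaring both sides removes the
    expectation. *)
Lemma exp_stable2P : exp_stable2 P xi S <->
  exists a lambda : R, [/\ 0 < a, 0 < lambda, lambda < 1 &
    forall k (x : 'cV[R]_n),
      (x^T *m iter k (kconj At) 1%:M *m x) 0 0 <= (a * lambda ^+ k) ^+ 2 * (x^T *m x) 0 0].
Proof.
have step (a lambda : R) k (x : 'cV[R]_n) : 0 < a -> 0 < lambda ->
    (sqrte 'E_P[fun w => (enorm (state xi S x (fun _ _ => 0%R) k w) ^+ 2)%R] <=
      (a * enorm x * lambda ^+ k)%:E)%E =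
    ((x^T *m iter k (kconj At) 1%:M *m x) 0 0 <= (a * lambda ^+ k) ^+ 2 * (x^T *m x) 0 0).
  move=> a0 l0; rewrite (state_mean xi_rv xi_indep xi_id repA) /= lee_fin.
  rewrite dotcolE; set q := (_ *m x) 0 0; set y := \sum_i _.
  have y0 : 0 <= y by apply: sumr_ge0 => i _; exact: sqr_ge0.
  have al : 0 <= a * lambda ^+ k by rewrite mulr_ge0 ?exprn_ge0 // ltW.
  rewrite -(ler_sqrt _ (mulr_ge0 (sqr_ge0 _) y0)) sqrtrM ?sqr_ge0 // sqrtr_sqr ger0_norm //.
  by rewrite mulrAC.
split=> -[a [l [a0 l0 l1 h]]]; exists a, l; split=> // k x.
  by rewrite -step.
by rewrite step.
Qed.

(** The summands are traces of nonnegative forms, so the partial sums increase and the limit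
    criterion applies. *)
Lemma h2norm_ltP (gamma : R) : 0 < gamma ->
  (h2norm P xi S < gamma%:E)%E <->
  exists2 s, s < gamma ^+ 2 & forall K,
    \tr (Emx P (fun w => (sysD S (xi 0%N w))^T *m sysD S (xi 0%N w))) +
     \sum_(k < K) \tr (kconj Bt (iter k (kconj At) (Ct^T *m Ct))) <= s.
Proof.
move=> g0; rewrite /h2norm (funext (h2sumE xi_rv xi_indep xi_id repA repB repC sqD)).
apply: sqrte_limn_lt => //.
apply/nondecreasing_seqP => K; rewrite lerD2l big_ord_recr /= lerDl.
apply/psd_trace/kconj_psd/iter_psd; first by move=> V; exact: kconj_psd.
by have := psdmx_conj Ct (@psdmx1 R (qz * qzu)); rewrite mulmx1.
Qed.

End Synthesis.

Theorem theorem5 (d : measure_display) (Omega : measurableType d) (R : realType)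
    (P : probability Omega R) (Z n pw pu qz : nat)
    (xi : nat -> Omega -> 'cV[R]_Z) (Xi : set 'cV[R]_Z)
    (xi_rv : forall k, random_vector (xi k))
    (xi_indep : independent_seq P xi)
    (xi_id : identically_distributed P xi)
    (xi_supp : forall k, law_support P (xi k) = Xi)
    (G : plant n pw pu qz Xi)
    (G_borel : borel_plant G)
    (G_sqint : square_integrable_plant P xi G)
    (nu qzu rw : nat)
    (nu_le : (nu <= (n + pu) * n)%N)
    (qzu_le : (qzu <= (n + pu) * qz)%N)
    (rw_le : (rw <= n * pw)%N)
    (GAB : 'M[R]_(nu, n * n + n * pu))
    (GCD : 'M[R]_(qzu, qz * n + qz * pu))
    (GBw : 'M[R]_(rw, n * pw))
    (GAB_def : factorAB P xi G GAB)
    (GCD_def : factorCD P xi G GCD)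
    (GBw_def : factorBw P xi G GBw)
    (gamma : R) (gamma_gt0 : 0 < gamma) :
  let ok (F : 'M[R]_(pu, n)) :=
    exp_stable2 P xi (closed_loop G F) /\
    (h2norm P xi (closed_loop G F) < gamma%:E)%E in
  ((exists F : 'M[R]_(pu, n), ok F) <->
   (exists (X : 'M[R]_n) (Y : 'M[R]_(pu, n)) (S : 'M[R]_pw),
      lmi_sol GAB GCD GBw (E_D P xi G) gamma X Y S)) /\
  (forall (X : 'M[R]_n) (Y : 'M[R]_(pu, n)) (S : 'M[R]_pw),
      lmi_sol GAB GCD GBw (E_D P xi G) gamma X Y S -> ok (Y *m invmx X)).

Proof.
move=> ok.
have cXi : closed Xi by rewrite -(xi_supp 0%N); exact: law_support_closed.
have [[bA bBw bBu] [bC bDw bDu]] := G_borel.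
have [[qA qBw qBu] [qC qDw qDu]] := G_sqint.
have coef m p (f : Xi -> 'M[R]_(m, p)) : borel_on f ->
    square_integrable P (ext0 f \o xi 0%N) -> sq_coef P xi (ext0 f).
  by move=> bf qf; split=> // i j; exact: ext0_measurable.
have repA F : moment_rep P xi (sysA (closed_loop G F)) (tA GAB + tBu GAB *m F) :=
  feedback_moment_rep xi_rv F (coef _ _ _ bA qA) (coef _ _ _ bBu qBu) GAB_def.
have repC F : moment_rep P xi (sysC (closed_loop G F)) (tC GCD + tDu GCD *m F) :=
  feedback_moment_rep xi_rv F (coef _ _ _ bC qC) (coef _ _ _ bDu qDu) GCD_def.
have repB : moment_rep P xi (Bow G) (tBw GBw) :=
  mxvec_moment_rep xi_rv (coef _ _ _ bBw qBw) GBw_def.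
have sqD := coef _ _ _ bDw qDw.
have stabP F := @exp_stable2P _ _ _ P _ xi xi_rv xi_indep xi_id _ _ _ _
  (closed_loop G F) _ (repA F).
have normP F := @h2norm_ltP _ _ _ P _ xi xi_rv xi_indep xi_id _ _ _ _ _ _
  (closed_loop G F) _ _ _ (repA F) repB (repC F) sqD gamma gamma_gt0.
have Q_psd F : psdmx ((tC GCD + tDu GCD *m F)^T *m (tC GCD + tDu GCD *m F)).
  by have := psdmx_conj (tC GCD + tDu GCD *m F) (@psdmx1 R (qz * qzu)); rewrite mulmx1.
have suff_lmi X Y S : lmi_sol GAB GCD GBw (E_D P xi G) gamma X Y S -> ok (Y *m invmx X).
  move=> [Xp Ss st pf trS]; set F := Y *m invmx X.
  have YE : Y = F *m X by rewrite mulmxKV // posdefmx_unit.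
  move: st; rewrite YE => /(lmi_stabP _ _ _ Xp) st.
  move: pf => /(lmi_perfP _ _ _ Xp) /posdefmx_psd/psd_trace; rewrite !linearB /= => pf.
  have Wp := posdefmx_inv Xp.
  split.
    apply/stabP; apply: (lyapunov_stable _ Wp (Q_psd F) st).
    exact: kconj_psd.
  (* tr S serves as the bound: the partial sums are at most tr E_D + tr E[B^T W B], and the second
     LMI keeps this at most tr S. *)
  apply/normP; exists (\tr S) => // K.
  have := lyapunov_sum_le (@kconj_psd _ _ _ _ (tA GAB + tBu GAB *m F)) K
    (posdefmx_psd Wp) (posdefmx_psd st).
  move=> /(kconj_psd (tBw GBw))/psd_trace.
  rewrite [kconj _ (_ - _)]linearB /= [kconj _ (bigop _ _ _)]linear_sum /=.
  rewrite [\tr (_ - _)]linearB /= [\tr (bigop _ _ _)]raddf_sum /=.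
  rewrite -/(E_D P xi G); move: pf; lra.
split; last exact: suff_lmi.
split; last by move=> [X [Y [S h]]]; exists (Y *m invmx X); exact: suff_lmi h.
move=> [F [/stabP [a [l [a0 l0 l1 st]]] /normP [s sg hs]]].
have Qs : ((tC GCD + tDu GCD *m F)^T *m (tC GCD + tDu GCD *m F))^T =
    (tC GCD + tDu GCD *m F)^T *m (tC GCD + tDu GCD *m F) by rewrite trmx_mul trmxK.
(* The Lyapunov construction is applied with cost map V |-> E[B^T V B], offset tr E_D and target
   gamma^2; X is the inverse of the resulting V. *)
have [V [Vp Vst Vtr]] := lyapunov_exists (@kconj_psd _ _ _ _ (tA GAB + tBu GAB *m F))
  (@kconj_psd _ _ _ _ (tBw GBw)) (@kconj_sym _ _ _ _ (tA GAB + tBu GAB *m F))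
  l0 l1 st Qs (Q_psd F) hs sg.
set X := invmx V; have Xp : posdefmx X := posdefmx_inv Vp.
have XV : invmx X = V by rewrite invmxK.
move: Vtr; rewrite -/(E_D P xi G); set c := \tr (E_D P xi G); set t := \tr (kconj _ _) => Vtr.
have EDs : (E_D P xi G)^T = E_D P xi G.
  apply/matrixP => i j; rewrite !mxE; congr fine; congr ('E_P[_])%E; apply/funext => w.
  by rewrite !mxE; apply: eq_bigr => k _; rewrite !mxE mulrC.
(* The remaining gap is divided by pw + 1, so that the trace e pw of e I stays strictly below it,
   also for pw = 0. *)
pose e := (gamma ^+ 2 - (c + t)) / (pw.+1)%:R.
have e0 : 0 < e by rewrite divr_gt0 ?subr_gt0 ?ltr0n.
(* The third witness is chosen so that the Schur complement of the second LMI is exactly e I. *)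
exists X, (F *m X), (E_D P xi G + kconj (tBw GBw) V + e%:M); split.
- exact: Xp.
- by rewrite !linearD /= EDs kconj_sym ?tr_scalar_mx //; case: Vp.
- by apply/lmi_stabP => //; rewrite XV.
- apply/lmi_perfP => //; rewrite XV.
  have cancelE (D K E : 'M[R]_pw) : D + K + E - D - K = E.
    by apply/matrixP => i j; rewrite !mxE; ring.
  rewrite cancelE; exact: posdefmx_scalar.
- have : e * pw.+1%:R = gamma ^+ 2 - (c + t) by rewrite divfK // pnatr_eq0.
  rewrite !linearD /= mxtrace_scalar -/c -/t -natr1 mulrDr mulr1 -mulr_natr; lra.
Qed.
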